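(* Let $\mathcal{F}(x_1,x_2,x_3)=\sum_{i,j,k=0}^{2}a_{ijk}x_1^ix_2^jx_3^k\in\mathbb{C}[x_1,x_2,x_3]$ be a strongly discriminantly separable polynomial, i.e. suppose there is a non-zero polynomial $P(x)=Ax^4+Bx^3+Cx^2+Dx+E\in\mathbb{C}[x]$ such that $$\mathcal{D}_{x_i}\mathcal{F}(x_j,x_k)=P(x_j)P(x_k)\qquad\text{for every cyclic permutation }(i,j,k)\text{ of }(1,2,3).\qquad ( * )$$ Modulo simultaneous fractional linear transformations of $x_1,x_2,x_3$ (the same transformation in each variable), such polynomials are exhausted by the following list, according to the structure of the zeros of $P$. That is, every such $\mathcal{F}$ is equivalent to one of the polynomials listed under the type of its $P$, and each listed polynomial satisfies $( * )$ with $P$ equal to the stated canonical form: (A) $P$ has four simple zeros; canonical form $P_A(x)=(k^2x^2-1)(x^2-1)$ (with $k\in\mathbb{C}$ such that the four zeros are distinct and finite, i.e. $k^2\neq 0,1$), and $$\mathcal{F}_A=\tfrac12\left(-k^2x_1^2-k^2x_2^2+1+k^2x_1^2x_2^2\right)x_3^2+(1-k^2)x_1x_2x_3+\tfrac12\left(x_1^2+x_2^2-k^2x_1^2x_2^2-1\right).$$ (B) $P$ has two simple zeros and one double zero; canonical form $P_B(x)=x^2-e^2$, $e\in\mathbb{C}$, $e\neq0$, and $$\mathcal{F}_B=x_1x_2x_3+\tfrac e2\left(x_1^2+x_2^2+x_3^2-e^2\right).$$ (C) $P$ has two double zeros; canonical form $P_C(x)=x^2$, and one of $$\mathcal{F}_{C_1}=\lambda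 x_1^2x_2^2+\mu x_1x_2x_3+\nu x_3^2,\qquad \mathcal{F}_{C_2}=\lambda x_1^2x_3^2+\mu x_1x_2x_3+\nu x_2^2,$$ $$\mathcal{F}_{C_3}=\lambda x_2^2x_3^2+\mu x_1x_2x_3+\nu x_1^2,\qquad \mathcal{F}_{C_4}=\lambda x_1^2x_2^2x_3^2+\mu x_1x_2x_3+\nu,$$ where in each case $\lambda,\mu,\nu\in\mathbb{C}$ satisfy $\mu^2-4\lambda\nu=1$. (D) $P$ has one simple and one triple zero; canonical form $P_D(x)=x$, and $$\mathcal{F}_D=-\tfrac12(x_1x_2+x_2x_3+x_1x_3)+\tfrac14(x_1^2+x_2^2+x_3^2).$$ (E) $P$ has one quadruple zero; canonical form $P_E(x)=1$, and one of $$\mathcal{F}_{E_1}=\lambda(x_1+x_2+x_3)^2+\mu(x_1+x_2+x_3)+\nu,\qquad \mathcal{F}_{E_2}=\lambda(x_2+x_3-x_1)^2+\mu(x_2+x_3-x_1)+\nu,$$ $$\mathcal{F}_{E_3}=\lambda(x_1+x_3-x_2)^2+\mu(x_1+x_3-x_2)+\nu,\qquad \mathcal{F}_{E_4}=\lambda(x_1+x_2-x_3)^2+\mu(x_1+x_2-x_3)+\nu,$$ where in each case $\lambda,\mu,\nu\in\mathbb{C}$ satisfy $\mu^2-4\lambda\nu=1$.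
   Context: $\mathcal{D}_{x_i}\mathcal{F}(x_j,x_k)$ denotes the discriminant of $\mathcal{F}$ regarded as a quadratic polynomial in $x_i$: if $\mathcal{F}=ax_i^2+bx_i+c$ with $a,b,c\in\mathbb{C}[x_j,x_k]$, then $\mathcal{D}_{x_i}\mathcal{F}=b^2-4ac$ (this formal expression is used even if $a=0$). Polynomials are of degree at most two in each variable. Zeros of $P$ and their multiplicities are counted on the projective line $\mathbb{C}\cup\{\infty\}$, with $P$ regarded as a polynomial of formal degree $4$; so if $\deg P=d<4$, then $\infty$ is a zero of multiplicity $4-d$. For given $\mathcal{F}$, condition $( * )$ determines $P$ only up to sign. Equivalence: the gauge group consists of transformations $x_i\mapsto\frac{ax_i+b}{cx_i+d}$, $i=1,2,3$, with the same $a,b,c,d\in\mathbb{C}$, $ad-bc\neq0$, for all three variables. It acts on polynomials of degree at most two in each variable by $$\mathcal{F}(x_1,x_2,x_3)\mapsto \prod_{i=1}^3(cx_i+d)^2\;\mathcal{F}\left(\tfrac{ax_1+b}{cx_1+d},\tfrac{ax_2+b}{cx_2+d},\tfrac{ax_3+b}{cx_3+d}\right).$$ Two polynomials are equivalent if one is obtained from the other by such a transformation. (Scalar matrices $a=d=t$, $b=c=0$ multiply $\mathcal{F}$ by $t^6$, so equivalence includes multiplication by non-zero constants.) *)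

(* Defs.v *)
From HB Require Import structures.
From mathcomp Require Import all_boot all_order all_algebra.
From mathcomp Require Import reals complex mpoly.

Set Implicit Arguments.
Unset Strict Implicit.
Unset Printing Implicit Defensive.

Import Order.TTheory GRing.Theory Num.Theory.
Local Open Scope ring_scope.

(* The complex numbers are R[i], for R a model of the real numbers. *)

Definition i1 : 'I_3 := @Ordinal 3 0 isT.
Definition i2 : 'I_3 := @Ordinal 3 1 isT.
Definition i3 : 'I_3 := @Ordinal 3 2 isT.

Local Notation x1 := ('X_i1 : {mpoly _[3]}).
Local Notation x2 := ('X_i2 : {mpoly _[3]}).
Local Notation x3 := ('X_i3 : {mpoly _[3]}).

Section Definitions.
Variable R : realType.
Implicit Types (F G : {mpoly R[i][3]}) (P : {poly R[i]}) (i : 'I_3).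

Definition deg_le2 F : Prop :=
  forall m, m \in msupp F -> forall i, (m i <= 2)%N.

(* The coefficient of x_i ^ n in F, as a polynomial in the other variables. *)
Definition coef_at i (n : nat) F : {mpoly R[i][3]} :=
  \sum_(m <- msupp F | m i == n) F@_m *: 'X_[m - U_(i) *+ n].

Definition discr i F : {mpoly R[i][3]} :=
  coef_at i 1 F ^+ 2 - 4%:R * coef_at i 2 F * coef_at i 0 F.

Definition in_var P i : {mpoly R[i][3]} :=
  (map_poly (@mpolyC 3 R[i]) P).['X_i].

Definition strongly_discr_sep F P : Prop :=
  [/\ deg_le2 F, P != 0, (size P <= 5)%N &
    [/\ discr i1 F = in_var P i2 * in_var P i3,
        discr i2 F = in_var P i3 * in_var P i1 &
        discr i3 F = in_var P i1 * in_var P i2]].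

(* Points of the projective line are elements of option R[i], None being the
   point at infinity; P <> 0 is viewed in formal degree 4. *)
Definition zero_mult P (z : option R[i]) : nat :=
  if z is Some x then mup x P else (4 - (size P).-1)%N.

(* The zeros of P on the projective line, listed without repetition in a
   suitable order, have multiplicities s. *)
Definition zero_type P (s : seq nat) : Prop :=
  exists zs : seq (option R[i]),
    [/\ uniq zs, [seq zero_mult P z | z <- zs] = s &
        forall z, (0 < zero_mult P z)%N -> z \in zs].

Definition num_at (a b : R[i]) i : {mpoly R[i][3]} := a *: 'X_i + b%:MP.

(* Computed in the field of fractions of R[i][x1, x2, x3]. *)
Definition gauge (a b c d : R[i]) F : {fraction {mpoly R[i][3]}} :=
  (\prod_(i < 3) tofrac (num_at c d i) ^+ 2) *
  mmap (fun z : R[i] => tofrac (z%:MP : {mpoly R[i][3]}))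
       (fun i => tofrac (num_at a b i) / tofrac (num_at c d i)) F.

(* G is obtained from F by a gauge transformation. These form a group acting on
   the polynomials satisfying deg_le2, so on these the relation is symmetric. *)
Definition equivalent F G : Prop :=
  exists a b c d : R[i], a * d - b * c != 0 /\ tofrac G = gauge a b c d F.

Implicit Types (k e l m n : R[i]).

Definition PA k : {poly R[i]} := (k ^+ 2 *: 'X^2 - 1) * ('X^2 - 1).

Definition FA k : {mpoly R[i][3]} :=
  2^-1 *: (- (k ^+ 2 *: x1 ^+ 2) - k ^+ 2 *: x2 ^+ 2 + 1
           + k ^+ 2 *: (x1 ^+ 2 * x2 ^+ 2)) * x3 ^+ 2
  + (1 - k ^+ 2) *: (x1 * x2 * x3)
  + 2^-1 *: (x1 ^+ 2 + x2 ^+ 2 - k ^+ 2 *: (x1 ^+ 2 * x2 ^+ 2) - 1).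

Definition PB e : {poly R[i]} := 'X^2 - (e ^+ 2)%:P.

Definition FB e : {mpoly R[i][3]} :=
  x1 * x2 * x3
  + (e / 2) *: (x1 ^+ 2 + x2 ^+ 2 + x3 ^+ 2 - (e ^+ 2)%:MP).

Definition PC : {poly R[i]} := 'X^2.

Definition FC1 l m n : {mpoly R[i][3]} :=
  l *: (x1 ^+ 2 * x2 ^+ 2) + m *: (x1 * x2 * x3) + n *: x3 ^+ 2.
Definition FC2 l m n : {mpoly R[i][3]} :=
  l *: (x1 ^+ 2 * x3 ^+ 2) + m *: (x1 * x2 * x3) + n *: x2 ^+ 2.
Definition FC3 l m n : {mpoly R[i][3]} :=
  l *: (x2 ^+ 2 * x3 ^+ 2) + m *: (x1 * x2 * x3) + n *: x1 ^+ 2.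
Definition FC4 l m n : {mpoly R[i][3]} :=
  l *: (x1 ^+ 2 * x2 ^+ 2 * x3 ^+ 2) + m *: (x1 * x2 * x3) + n%:MP.

Definition PD : {poly R[i]} := 'X.

Definition FD : {mpoly R[i][3]} :=
  - (2^-1 *: (x1 * x2 + x2 * x3 + x1 * x3))
  + 4^-1 *: (x1 ^+ 2 + x2 ^+ 2 + x3 ^+ 2).

Definition PE : {poly R[i]} := 1.

Definition FE1 l m n : {mpoly R[i][3]} :=
  l *: (x1 + x2 + x3) ^+ 2 + m *: (x1 + x2 + x3) + n%:MP.
Definition FE2 l m n : {mpoly R[i][3]} :=
  l *: (x2 + x3 - x1) ^+ 2 + m *: (x2 + x3 - x1) + n%:MP.
Definition FE3 l m n : {mpoly R[i][3]} :=
  l *: (x1 + x3 - x2) ^+ 2 + m *: (x1 + x3 - x2) + n%:MP.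
Definition FE4 l m n : {mpoly R[i][3]} :=
  l *: (x1 + x2 - x3) ^+ 2 + m *: (x1 + x2 - x3) + n%:MP.

End Definitions.

Arguments PC {R}.
Arguments PD {R}.
Arguments FD {R}.
Arguments PE {R}.

(* Main.v *)
Require Import Defs.
From HB Require Import structures.
From mathcomp Require Import all_boot all_order all_algebra.
From mathcomp Require Import reals complex mpoly.
From mathcomp Require Import ring.

(* Homogenize F to a form f, quadratic in each of three pairs (x.1, x.2) that
   stand for x = x.1 / x.2, and P to a binary quartic Q.  The three discriminants
   of f are then Q x * Q y, and a gauge transformation is a linear substitution on
   pairs.
   If Q has a simple zero, move it to infinity and another zero to 0.  If the
   coefficient of x^2 y^2 z^2 in f vanishes, the other coefficients are determined
   up to a common factor; if not, the coefficients of x^2, y^2 and z^2 in f are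
   squares of bilinear polynomials, and a translation followed by an inversion
   t -> - s / t leads back to the first case.  This gives types A, B and D.
   If Q has double zeros at 0 and infinity, inverting the variables one by one
   preserves the hypothesis and makes the coefficient of x^2 y^2 z^2 non-zero,
   unless f is a multiple of x y z; so f is C4 up to such inversions.
   If Q has a quadruple zero at infinity, the discriminants are constant, so f
   has total degree at most 2 and is a polynomial in some x +- y +- z. *)

Set Implicit Arguments.
Unset Strict Implicit.
Unset Printing Implicit Defensive.

Import Order.TTheory GRing.Theory Num.Theory.
Local Open Scope ring_scope.

(** The hypothesis treats the three variables without assuming any symmetry of f, whereas a gauge
    transformation acts on all of them in the same way. In types C and E the asymmetry is real:
    inverting one variable, or changing its sign, yields the four families. When Q has a simple zero
    it must be excluded, and most coefficient comparisons below serve this purpose. The two cases of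
    a simple zero come from the group law of the curve w^2 = t (t^2 + L t - s), whose right-hand
    side is Q up to a factor and a translation. For four simple zeros, f vanishes where the points
    over x, y, z, with suitable signs, add up to a fixed point T with 2 T = 0. The coefficient of
    x^2 y^2 z^2 tests the triple of points at infinity, so it vanishes exactly for T = 0. Otherwise
    T lies over a finite zero of Q; once that zero is moved to 0, adding T to each point is t -> - s
    / t, and as 3 T = T this leads to the case T = 0. The degenerate curves obey the same formulas.
    A constant factor on f multiplies Q by the same constant and is itself a gauge transformation,
    so Q matters only up to a constant. *)

Section Algebra.
Variable K : numClosedFieldType.
Local Notation V := (K * K)%type.
Implicit Types (x y z : V) (f g : V -> V -> V -> K) (q : V -> K).
Implicit Types (a : nat -> nat -> nat -> K) (P : nat -> K).

Local Notation "a .< i , j , k >" := (a i%N j%N k%N)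
  (at level 2, left associativity, i, j, k at level 0,
   format "a .< i , j , k >").

(** Certificates: [lcM] and [lcD] assemble b = c as a linear combination of known equations, and the
    identity u - v = b - c is left to [ring] or [field]. *)
Lemma lincomb (u v b c : K) : b = c -> u - v = b - c -> u = v.
Proof. by move=> -> ; rewrite subrr => /subr0_eq. Qed.

Lemma lcM (k b c : K) : b = c -> k * b = k * c.
Proof. by move->. Qed.

Lemma lcD (b c b' c' : K) : b = c -> b' = c' -> b + b' = c + c'.
Proof. by move=> -> ->. Qed.

Lemma poly_fun_eq0 (p : {poly K}) : (forall t, p.[t] = 0) -> p = 0.
Proof.
move=> h; apply: (@roots_geq_poly_eq0 _ _ [seq i%:R | i <- iota 0 (size p)]).
- by apply/allP => t _; apply/rootP.
- rewrite map_inj_uniq ?iota_uniq // => i j /eqP.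
  by rewrite eqr_nat => /eqP.
- by rewrite size_map size_iota.
Qed.

(** The index type is arbitrary because the sums range over ordinals as well as over supports of
    polynomials in several variables; the predicate [p] allows one variable to be treated after
    another. *)
Lemma pow_sum_eq0 (I : eqType) (s : seq I) (p : pred I) (c : I -> K) (e : I -> nat) :
  (forall t, \sum_(i <- s | p i) c i * t ^+ e i = 0) ->
  forall n, \sum_(i <- s | p i && (e i == n)) c i = 0.
Proof.
move=> h n; have P0 : \sum_(i <- s | p i) c i *: 'X^(e i) = 0.
  apply: poly_fun_eq0 => t; rewrite horner_sum -[RHS](h t).
  by apply: eq_bigr => i _; rewrite hornerZ hornerXn.
have := congr1 (fun r : {poly K} => r`_n) P0; rewrite coef0 coef_sum => P0n.
rewrite -[RHS]P0n big_mkcondr; apply: eq_bigr => i _; rewrite coefZ coefXn eq_sym.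
by case: eqP; rewrite ?mulr1 ?mulr0.
Qed.

(** * Binary quadratic forms and their discriminants *)

Definition qcoef (k : nat) q : K :=
  match k with
  | 0 => q (0, 1)
  | 1 => q (1, 1) - q (1, 0) - q (0, 1)
  | 2 => q (1, 0)
  | _ => 0
  end.

(** Forms remain bare functions, with coefficients recovered from the values at (1, 0), (0, 1) and
    (1, 1), so that substitutions are mere compositions. *)
Definition qform q : Prop := forall z,
  q z = qcoef 2 q * z.1 ^+ 2 + qcoef 1 q * (z.1 * z.2) + qcoef 0 q * z.2 ^+ 2.

Lemma qformI (c2 c1 c0 : K) q :
  (forall z, q z = c2 * z.1 ^+ 2 + c1 * (z.1 * z.2) + c0 * z.2 ^+ 2) -> qform q.
Proof. by move=> h z; rewrite /qcoef !h /=; ring. Qed.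

Lemma qcoefI (c2 c1 c0 : K) q :
  (forall z, q z = c2 * z.1 ^+ 2 + c1 * (z.1 * z.2) + c0 * z.2 ^+ 2) ->
  [/\ qcoef 2 q = c2, qcoef 1 q = c1 & qcoef 0 q = c0].
Proof. by move=> h; split; rewrite /qcoef !h /=; ring. Qed.

Definition qdisc q : K := qcoef 1 q ^+ 2 - 4 * qcoef 2 q * qcoef 0 q.

Definition mact (A : K * K * (K * K)) z : V :=
  (A.1.1 * z.1 + A.1.2 * z.2, A.2.1 * z.1 + A.2.2 * z.2).

Definition mdet (A : K * K * (K * K)) : K := A.1.1 * A.2.2 - A.1.2 * A.2.1.

Lemma qform_mact A q : qform q -> qform (fun z => q (mact A z)).
Proof.
move=> h; pose b := A.1.1; pose c := A.1.2; pose d := A.2.1; pose e := A.2.2.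
apply: (@qformI (qcoef 2 q * b ^+ 2 + qcoef 1 q * (b * d) + qcoef 0 q * d ^+ 2)
  (qcoef 2 q * (2 * b * c) + qcoef 1 q * (b * e + c * d) + qcoef 0 q * (2 * d * e))
  (qcoef 2 q * c ^+ 2 + qcoef 1 q * (c * e) + qcoef 0 q * e ^+ 2)) => z.
by rewrite h /= /b /c /d /e; ring.
Qed.

Lemma disc_mact A q : qform q ->
  qdisc (fun z => q (mact A z)) = mdet A ^+ 2 * qdisc q.
Proof.
by move=> h; rewrite /qdisc /qcoef !h /mdet /qcoef /=; ring.
Qed.

Lemma disc_scale (c : K) q : qdisc (fun z => c * q z) = c ^+ 2 * qdisc q.
Proof. by rewrite /qdisc /qcoef; ring. Qed.

(** * Forms in three pairs and the gauge action *)

Definition triq f : Prop :=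
  [/\ forall y z, qform (fun x => f x y z), forall x z, qform (fun y => f x y z)
    & forall x y, qform (fun z => f x y z)].

Definition mobius_act A f x y z : K := f (mact A x) (mact A y) (mact A z).

Lemma triq_act A f : triq f -> triq (mobius_act A f).
Proof.
case=> hx hy hz; split=> u v.
- exact: (@qform_mact A (fun x => f x (mact A u) (mact A v))).
- exact: (@qform_mact A (fun y => f (mact A u) y (mact A v))).
- exact: (@qform_mact A (fun z => f (mact A u) (mact A v) z)).
Qed.

Lemma qform_scale (c : K) q : qform q -> qform (fun z => c * q z).
Proof. by move=> h z; rewrite h /qcoef; ring. Qed.

Lemma triq_scale (c : K) f : triq f -> triq (fun x y z => c * f x y z).
Proof. by case=> hx hy hz; split=> u v; apply: qform_scale. Qed.

Definition sds f q : Prop := forall x y,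
  [/\ qdisc (fun z => f z x y) = q x * q y, qdisc (fun z => f y z x) = q x * q y
    & qdisc (fun z => f x y z) = q x * q y].

(** A discriminant is multiplied by [mdet A ^+ 2]; each of the two copies of [q] receives one
    factor. *)
Lemma sds_act A f q : triq f -> sds f q ->
  sds (mobius_act A f) (fun x => mdet A * q (mact A x)).
Proof.
move=> [hx hy hz] h x y; have [h1 h2 h3] := h (mact A x) (mact A y).
rewrite mulrACA -expr2; split.
- by rewrite -h1 -(disc_mact A) //; apply: hx.
- by rewrite -h2 -(disc_mact A) //; apply: hy.
- by rewrite -h3 -(disc_mact A) //; apply: hz.
Qed.

Lemma sds_scale (c : K) f q : sds f q -> 
  sds (fun x y z => c * f x y z) (fun x => c * q x).
Proof.
move=> h x y; have [h1 h2 h3] := h x y.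
by rewrite mulrACA -expr2; split; rewrite disc_scale ?h1 ?h2 ?h3.
Qed.

Definition eqv f g : Prop :=
  exists2 A, mdet A != 0 & forall x y z, g x y z = mobius_act A f x y z.

Lemma eqv_trans g f h : eqv f g -> eqv g h -> eqv f h.
Proof.
move=> [A dA hg] [B dB hh].
exists ((A.1.1 * B.1.1 + A.1.2 * B.2.1, A.1.1 * B.1.2 + A.1.2 * B.2.2),
  (A.2.1 * B.1.1 + A.2.2 * B.2.1, A.2.1 * B.1.2 + A.2.2 * B.2.2)).
  apply: contra_neq (mulf_neq0 dA dB) => <-; rewrite /mdet /=; ring.
move=> x y z; rewrite hh /mobius_act hg /mobius_act /mact /=.
by congr f; congr pair; ring.
Qed.

(** The scalar matrix t multiplies a form of degree 2 in each of three pairs by t^6, hence the sixth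
    root. *)
Lemma eqv_scale (c : K) f g : triq f -> c != 0 ->
  (forall x y z, g x y z = c * f x y z) -> eqv f g.
Proof.
move=> [hx hy hz] c0 gE; pose t := 6.-root c.
have tE : t ^+ 6 = c by rewrite rootCK.
have t0 : t != 0 by apply: contra_neq c0 => t0; rewrite -tE t0 expr0n.
exists ((t, 0), (0, t)); first by rewrite /mdet /= mulr0 subr0 mulf_neq0.
have e q : qform q -> forall z, q (mact ((t, 0), (0, t)) z) = t ^+ 2 * q z.
  by move=> h z; rewrite h [in RHS]h /=; ring.
move=> x y z; rewrite gE /mobius_act.
rewrite (e _ (hx _ _)) (e (fun y => f x y _) (hy _ _)) (e _ (hz _ _)) -tE.
by ring.
Qed.

Lemma eqv_act A f : mdet A != 0 -> eqv f (mobius_act A f).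
Proof. by exists A. Qed.

(** * Coefficient tables and the discriminant equations *)

Definition table f (i j k : nat) : K :=
  qcoef i (fun x => qcoef j (fun y => qcoef k (fun z => f x y z))).

Definition tform a x y z : K :=
  \sum_(i < 3) \sum_(j < 3) \sum_(k < 3) a i j k *
  ((x.1 ^+ i * x.2 ^+ (2 - i)) * (y.1 ^+ j * y.2 ^+ (2 - j)) *
  (z.1 ^+ k * z.2 ^+ (2 - k))).

Lemma tableE f : triq f -> forall x y z, f x y z = tform (table f) x y z.
Proof.
move=> [hx hy hz] x y z; rewrite /tform !big_ord_recr !big_ord0 /= /table /= !subn0 !subnn.
have -> : (2 - 1)%N = 1%N by [].
rewrite (hx y z) /qcoef (hy (1, 0) z) (hy (0, 1) z) (hy (1, 1) z) /qcoef.
rewrite !(hz _ _ z) /qcoef; ring.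
Qed.

(** Coefficients of a product of two polynomials of degree 2. The product [m] of coefficients is a
    parameter, so that nesting covers two variables. *)
Definition conv3 (T : Type) (m : T -> T -> K) (u v : nat -> T) (n : nat) : K :=
  match n with
  | 0 => m (u 0%N) (v 0%N)
  | 1 => m (u 0%N) (v 1%N) + m (u 1%N) (v 0%N)
  | 2 => m (u 0%N) (v 2%N) + m (u 1%N) (v 1%N) + m (u 2%N) (v 0%N)
  | 3 => m (u 1%N) (v 2%N) + m (u 2%N) (v 1%N)
  | 4 => m (u 2%N) (v 2%N)
  | _ => 0
  end.

Definition conv2 (u v : nat -> nat -> K) (i j : nat) : K :=
  conv3 (fun r s => conv3 *%R r s j) u v i.

Definition dcoef a i j : K :=
  conv2 (fun k l => a k l 1%N) (fun k l => a k l 1%N) i j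
  - 4 * conv2 (fun k l => a k l 2%N) (fun k l => a k l 0%N) i j.

Definition rot3 (T : Type) (a : T -> T -> T -> K) : T -> T -> T -> K :=
  fun i j k => a k i j.

(** In the proofs below [E3], [E1], [E2] are these equations for [a], [rot3 a], [rot3 (rot3 a)]:
    they come from the discriminants in z, x, y, and their indices are the exponents of (x, y), (y,
    z), (z, x). *)
Definition deqs a P : Prop := forall i j, (i < 5)%N -> (j < 5)%N ->
  dcoef a i j = P i * P j.

Lemma triq_rot f : triq f -> triq (rot3 f).
Proof. by case=> hx hy hz; split=> u v; rewrite /rot3; [apply: hy|apply: hz|apply: hx]. Qed.

Lemma sds_rot f q : sds f q -> sds (rot3 f) q.
Proof. by move=> h x y; have [h1 h2 h3] := h x y; split. Qed.

Lemma table_rot f i j k : table (rot3 f) i j k = rot3 (table f) i j k.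
Proof.
by rewrite /table /rot3; case: i => [|[|[|i]]]; case: j => [|[|[|j]]];
  case: k => [|[|[|k]]]; rewrite /qcoef //; ring.
Qed.

Lemma biquartic_eq0 (c : nat -> nat -> K) :
  (forall s t, \sum_(i < 5) \sum_(j < 5) c i j * s ^+ i * t ^+ j = 0) ->
  forall i j, (i < 5)%N -> (j < 5)%N -> c i j = 0.
Proof.
move=> h i j hi hj.
have h1 t : \sum_(k < 5 | true && (k == i :> nat))
    (\sum_(l < 5) c k l * t ^+ l) = 0.
  apply: pow_sum_eq0 => s; rewrite -[RHS](h s t); apply: eq_bigr => k _.
  by rewrite mulr_suml; apply: eq_bigr => l _; ring.
have h2 t : \sum_(l < 5) c i l * t ^+ l = 0.
  by have := h1 t; rewrite (big_pred1 (Ordinal hi)) // => k; rewrite -val_eqE.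
have := pow_sum_eq0 h2 j.
by rewrite (big_pred1 (Ordinal hj)) // => k; rewrite -val_eqE.
Qed.

Lemma conv2E (u v : nat -> nat -> K) (s t : K) :
  (\sum_(i < 3) \sum_(j < 3) u i j * s ^+ i * t ^+ j)
    * (\sum_(i < 3) \sum_(j < 3) v i j * s ^+ i * t ^+ j) =
  \sum_(i < 5) \sum_(j < 5) conv2 u v i j * s ^+ i * t ^+ j.
Proof. by rewrite !big_ord_recr !big_ord0 /= /conv2 /conv3; ring. Qed.

Lemma qcoef_table f : triq f -> forall k s t, (k < 3)%N ->
  qcoef k (f (s, 1) (t, 1)) =
  \sum_(i < 3) \sum_(j < 3) table f i j k * s ^+ i * t ^+ j.
Proof.
move=> tf k s t hk; pose F k := \sum_(i < 3) \sum_(j < 3) table f i j k * s ^+ i * t ^+ j.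
have [e2 e1 e0] : [/\ qcoef 2 (f (s, 1) (t, 1)) = F 2%N,
    qcoef 1 (f (s, 1) (t, 1)) = F 1%N & qcoef 0 (f (s, 1) (t, 1)) = F 0%N].
  apply: qcoefI => z; rewrite (tableE tf) /tform /F !big_ord_recr !big_ord0 /=.
  by rewrite !expr1n; ring.
by case: k hk => [|[|[|k]]].
Qed.

Lemma sds_deqs f q P : triq f -> sds f q ->
  (forall t, q (t, 1) = \sum_(i < 5) P i * t ^+ i) -> deqs (table f) P.
Proof.
move=> tf h hq i j hi hj; apply/eqP; rewrite -subr_eq0; apply/eqP.
apply: (biquartic_eq0 (c := fun i j => dcoef (table f) i j - P i * P j)) => // s t.
have [_ _] := h (s, 1) (t, 1); rewrite /qdisc !qcoef_table // !hq => /eqP.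
rewrite -subr_eq0 => /eqP h0; rewrite -[RHS]h0 expr2 -mulrA.
pose u k i j := table f i j k.
rewrite (conv2E (u 1%N) (u 1%N)) (conv2E (u 2%N) (u 0%N)) mulr_suml.
rewrite mulr_sumr -!sumrB. apply: eq_bigr => k _.
rewrite !mulr_sumr -!sumrB. apply: eq_bigr => l _.
by rewrite /dcoef /u; ring.
Qed.

Lemma eq_deqs a b P : (forall i j k, a i j k = b i j k) ->
  deqs a P -> deqs b P.
Proof.
move=> h ha i j hi hj; rewrite -ha // /dcoef /conv2 /conv3.
by case: i {hi} => [|[|[|[|[|i]]]]] //; case: j {hj} => [|[|[|[|[|j]]]]] //;
  rewrite !h.
Qed.

Lemma sds_deqs3 f q P : triq f -> sds f q ->
  (forall t, q (t, 1) = \sum_(i < 5) P i * t ^+ i) ->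
  [/\ deqs (table f) P, deqs (rot3 (table f)) P & deqs (rot3 (rot3 (table f))) P].
Proof.
move=> tf sf hq; have tr := triq_rot tf; have sr := sds_rot sf.
split; first exact: sds_deqs hq.
  apply: (eq_deqs (a := table (rot3 f))); first exact: table_rot.
  exact: sds_deqs hq.
apply: (eq_deqs (a := table (rot3 (rot3 f)))); last first.
  by apply: sds_deqs hq; [apply: triq_rot|apply: sds_rot].
by move=> i j k; rewrite table_rot /rot3 table_rot.
Qed.

(** * A simple zero at infinity: reduction to [FW] *)

Lemma nz2 : (2 : K) != 0. Proof. by rewrite pnatr_eq0. Qed.
Lemma nz4 : (4 : K) != 0. Proof. by rewrite pnatr_eq0. Qed.

(* The coefficient of x^2 in the form is (y z + c y + b z + s)^2, where
   c = a221 / 2 and b = a212 / 2. *)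
Lemma face_square a P : deqs a P -> deqs (rot3 (rot3 a)) P -> P 4%N = 0 ->
  a.<2,2,2> = 1 ->
  [/\ a.<2,2,0> = (a.<2,2,1> / 2) ^+ 2, a.<2,0,2> = (a.<2,1,2> / 2) ^+ 2 &
   let s := a.<2,1,1> / 2 - a.<2,2,1> / 2 * (a.<2,1,2> / 2) in
   [/\ a.<2,1,0> = a.<2,2,1> * s, a.<2,0,1> = a.<2,1,2> * s & a.<2,0,0> = s ^+ 2]].
Proof.
move=> E3 E2 P4 a1.
(* As [P 4] vanishes, so do the coefficients of x^4 in the discriminants in z and y. These are the
   discriminants in z and y of the coefficient of x^2. *)
have e44 := E3 4 4 isT isT; have e43 := E3 4 3 isT isT.
have e42 := E3 4 2 isT isT; have h44 := E2 4 4 isT isT.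
have h34 := E2 3 4 isT isT.
rewrite /dcoef /conv2 /conv3 /rot3 /= P4 ?a1 ?mul0r ?mulr0 in e44 e43 e42 h44 h34.
have d20 : (a.<2,2,0> = (a.<2,2,1> / 2) ^+ 2).
  by apply: (lincomb (lcM (- 4^-1) e44)); field.
have d02 : (a.<2,0,2> = (a.<2,1,2> / 2) ^+ 2).
  by apply: (lincomb (lcM (- 4^-1) h44)); field.
rewrite d20 d02 in e43 e42 h34 *.
set s := _ - _.
have d10 : (a.<2,1,0> = a.<2,2,1> * s).
  by rewrite /s; apply: (lincomb (lcM (- 4^-1) e43)); field.
have d01 : (a.<2,0,1> = a.<2,1,2> * s).
  by rewrite /s; apply: (lincomb (lcM (- 4^-1) h34)); field.
rewrite d10 d01 in e42 *; split=> //=; split=> //.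
by apply: (lincomb (lcM (- 4^-1) e42)); rewrite /s; field.
Qed.

(** A single translation must remove the analogous coefficients of all three variables, so they have
    to agree. [e32] and [h23] both express P 3 times P 2; their left-hand sides differ by a
    combination of those of [e33] and [h33], and what remains is 3/2 (c - b) (P 3)^2 = 0. *)
Lemma monic_edge_eq a P : deqs a P -> deqs (rot3 a) P -> deqs (rot3 (rot3 a)) P ->
  P 4%N = 0 -> P 3%N != 0 -> a.<2,2,2> = 1 -> a.<2,2,1> = a.<2,1,2>.
Proof.
move=> E3 E1 E2 P4 P3 a1.
have [a220 a202 [a210 a201 a200]] := face_square E3 E2 P4 a1.
have [] := face_square (a := rot3 a) E1 E3 P4 a1.
rewrite /rot3 => a022 _ [a021 a120 a020].
have [] := face_square (a := rot3 (rot3 a)) E2 E1 P4 a1.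
rewrite /rot3 => _ _ [a102 a012 a002].
have e33 := E3 3 3 isT isT; have e32 := E3 3 2 isT isT.
have h33 := E2 3 3 isT isT; have h23 := E2 2 3 isT isT.
rewrite /dcoef /conv2 /conv3 /rot3 /= in e33 e32 h33 h23.
rewrite !(a1, a220, a202, a210, a201, a200, a022, a021, a120, a020, a102, a012, a002)
  in e33 e32 h33 h23.
set c := a.<2,2,1>; set b := a.<2,1,2>.
apply: (lincomb (lcM (- (3 / 2 * P 3%N ^+ 2)^-1)
  (lcD e32 (lcD (lcM (-1) h23) (lcD (lcM (3 * (c / 2)) h33) (lcM (- 3 * (b / 2)) e33)))))).
by rewrite -/c -/b; field.
Qed.

(** With e1, e2, e3 the elementary symmetric functions of x, y, z, this is (e2 + s)^2 - 4 e3 (e1 +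
    L). It is the relation between the abscissas of three collinear points of w^2 = t (t^2 + L t -
    s), found by eliminating the coefficients of the line. *)
Definition FW (L s : K) (x y z : V) : K :=
  x.1 ^+ 2 * y.1 ^+ 2 * z.2 ^+ 2 + x.1 ^+ 2 * y.2 ^+ 2 * z.1 ^+ 2
  + x.2 ^+ 2 * y.1 ^+ 2 * z.1 ^+ 2
  - 2 * (x.1 * y.1 * z.1) * (x.1 * y.2 * z.2 + x.2 * y.1 * z.2 + x.2 * y.2 * z.1)
  - 4 * L * (x.1 * x.2 * y.1 * y.2 * z.1 * z.2)
  + 2 * s * (x.2 * y.2 * z.2) * (x.1 * y.1 * z.2 + x.1 * y.2 * z.1 + x.2 * y.1 * z.1)
  + s ^+ 2 * (x.2 ^+ 2 * y.2 ^+ 2 * z.2 ^+ 2).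

(** With the translation done, P is P 3 times t (t^2 + L t - s), and the matrix t -> - s / t
    exchanges 0 with infinity and the two other zeros with each other. *)
Lemma tab_monic a P : deqs a P -> deqs (rot3 a) P -> deqs (rot3 (rot3 a)) P ->
  P 4%N = 0 -> P 3%N != 0 -> a.<2,2,2> = 1 ->
  a.<2,2,1> = 0 -> a.<2,1,2> = 0 -> a.<1,2,2> = 0 ->
  exists s, [/\ s != 0, P 1%N = - (s * P 3%N), P 0%N = 0 &
    forall x y z, mobius_act ((0, - s), (1, 0)) (tform a) x y z =
      s ^+ 4 * FW (P 2%N / P 3%N) s x y z].
Proof.
move=> E3 E1 E2 P4 P3 a1 a221 a212 a122.
have [] := face_square E3 E2 P4 a1.
have [] := face_square (a := rot3 a) E1 E3 P4 a1.
have [] := face_square (a := rot3 (rot3 a)) E2 E1 P4 a1.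
rewrite /rot3 a221 a212 a122 !mul0r expr0n /= !subr0.
move=> _ _ [a102 a012 a002] a022 _ [a021 a120 a020] a220 a202 [a210 a201 a200].
pose s := a.<2,1,1> / 2; pose s2 := a.<1,2,1> / 2; pose s3 := a.<1,1,2> / 2.
have a211 : a.<2,1,1> = 2 * s by rewrite /s; field.
have a121 : a.<1,2,1> = 2 * s2 by rewrite /s2; field.
have a112 : a.<1,1,2> = 2 * s3 by rewrite /s3; field.
rewrite -/s in a200; rewrite -/s2 in a020; rewrite -/s3 in a002.
have vals := (P4, a1, a221, a212, a122, a220, a202, a022, a211, a121, a112,
  a210, a201, a200, a021, a120, a020, a102, a012, a002).
clearbody s s2 s3.
have e33 := E3 3 3 isT isT; have e32 := E3 3 2 isT isT.
have e31 := E3 3 1 isT isT; have e30 := E3 3 0 isT isT.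
have e13 := E3 1 3 isT isT; have e23 := E3 2 3 isT isT.
have h33 := E2 3 3 isT isT; have h31 := E2 3 1 isT isT.
have h32 := E2 3 2 isT isT.
have g33 := E1 3 3 isT isT.
rewrite /dcoef /conv2 /conv3 /rot3 /= !vals in e33 e32 e31 e30 e13 e23 h33 h31 h32 g33.
have a110 : a.<1,1,0> = 2 * s * s2 - P 3%N ^+ 2 / 4.
  by apply: (lincomb (lcM (- 4^-1) e33)); field.
have a101 : a.<1,0,1> = 2 * s * s3 - P 3%N ^+ 2 / 4.
  by apply: (lincomb (lcM (- 4^-1) h33)); field.
have a011 : a.<0,1,1> = 2 * s2 * s3 - P 3%N ^+ 2 / 4.
  by apply: (lincomb (lcM (- 4^-1) g33)); field.
rewrite !(a110, a101, a011) in e31 e13 h31.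
(* The coefficients of x^2, y^2, z^2 are the squares of y z + s, x z + s2, x y + s3. Three
   expressions for [P 1] identify these constants. *)
have P1 : P 1%N = - (s * P 3%N).
  by apply: (lincomb (lcM (- (P 3%N)^-1) e31)); field.
have P12 : P 1%N = - (s2 * P 3%N).
  by apply: (lincomb (lcM (- (P 3%N)^-1) e13)); field.
have P13 : P 1%N = - (s3 * P 3%N).
  by apply: (lincomb (lcM (- (P 3%N)^-1) h31)); field.
have E2s : s2 = s.
  by apply: (mulIf P3); apply: oppr_inj; rewrite -P12 -P1.
have E3s : s3 = s.
  by apply: (mulIf P3); apply: oppr_inj; rewrite -P13 -P1.
subst s2 s3.
have P0 : P 0%N = 0.
  by apply: (lincomb (lcM (- (P 3%N)^-1) e30)); field.
have e20 := E3 2 0 isT isT; have e10 := E3 1 0 isT isT.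
have e00 := E3 0 0 isT isT.
rewrite /dcoef /conv2 /conv3 /rot3 /= !vals !(a110, a101, a011) in e20 e10 e00.
rewrite P0 !mulr0 in e20 e10 e00.
have P32 : P 3%N ^+ 2 = 16 * s ^+ 2.
  apply: (lincomb (lcM (16 / P 3%N ^+ 2) e20)); by field.
have s0 : s != 0.
  by apply: contra_neq P3 => s0; apply/eqP; rewrite -sqrf_eq0 P32 s0 expr0n mulr0.
pose L := P 2%N / P 3%N; exists s.
have a100 : a.<1,0,0> = s * a.<1,1,1> - P 3%N * P 2%N / 4.
  by apply: (lincomb (lcM (- 4^-1) e32)); field.
have a010 : a.<0,1,0> = s * a.<1,1,1> - P 3%N * P 2%N / 4.
  by apply: (lincomb (lcM (- 4^-1) e23)); field.
have a001 : a.<0,0,1> = s * a.<1,1,1> - P 3%N * P 2%N / 4.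
  by apply: (lincomb (lcM (- 4^-1) h32)); field.
have z1 : s * a.<1,1,1> - P 3%N * P 2%N / 4 = 0.
  rewrite a100 a001 P32 in e10.
  by apply: (lincomb (lcM (- (8 * s ^+ 2)^-1) e10)); field.
rewrite z1 in a100 a010 a001.
have a000 : a.<0,0,0> = 0.
  rewrite a001 in e00.
  by apply: (lincomb (lcM (- (4 * s ^+ 2)^-1) e00)); field.
have a111 : a.<1,1,1> = 4 * s * L.
  rewrite /L; apply: (lincomb (lcD (lcM (s^-1) z1) (lcM (P 2%N / (4 * s * P 3%N)) P32))).
  by field; apply/andP.
have a110' : a.<1,1,0> = - 2 * s ^+ 2 by rewrite a110 P32; field.
have a101' : a.<1,0,1> = - 2 * s ^+ 2 by rewrite a101 P32; field.
have a011' : a.<0,1,1> = - 2 * s ^+ 2 by rewrite a011 P32; field.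
split=> // x y z; rewrite /mobius_act /mact /= -/L !mul0r !add0r !mul1r addr0.
rewrite /tform !big_ord_recr !big_ord0 /= !vals.
rewrite a111 a110' a101' a011' a100 a010 a001 a000 /FW; ring.
Qed.

(** The centre [t0] is dictated by f: it is some zero of q, and cannot be prescribed. *)
Lemma cubic_monic f q (p2 p1 p0 l : K) : triq f -> sds f q -> l != 0 ->
  (forall t, q (t, 1) = p0 + p1 * t + p2 * t ^+ 2 + l * t ^+ 3) ->
  f (1, 0) (1, 0) (1, 0) = 1 ->
  exists t0 L s, [/\ s != 0,
    (forall t, q (t + t0, 1) = l * (t * (t ^+ 2 + L * t - s))) & eqv f (FW L s)].
Proof.
move=> tf sf l0 hq f1.
pose P n := nth 0 [:: p0; p1; p2; l; 0] n.
have qP t : q (t, 1) = \sum_(i < 5) P i * t ^+ i.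
  by rewrite hq !big_ord_recr big_ord0 /P /=; ring.
have [E3 E1 E2] := sds_deqs3 tf sf qP.
have e1 : (table f).<2,2,1> = (table f).<2,1,2>.
  exact: (monic_edge_eq E3 E1 E2).
have e2 : (table f).<1,2,2> = (table f).<2,2,1>.
  exact: (monic_edge_eq (a := rot3 (table f)) E1 E2 E3).
pose t0 := - (table f).<2,2,1> / 2.
pose A : K * K * (K * K) := ((1, t0), (0, 1)).
have dA : mdet A = 1 by rewrite /mdet /A /=; ring.
have tA := triq_act A tf; have sA := sds_act A tf sf.
have mt t : mact A (t, 1) = (t + t0, 1).
  by rewrite /mact /A /=; congr pair; ring.
(* The Taylor coefficients of q at [t0]. *)
pose Q n := nth 0 [:: q (t0, 1); p1 + 2 * p2 * t0 + 3 * l * t0 ^+ 2; p2 + 3 * l * t0; l; 0] n.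
have qQ t : mdet A * q (mact A (t, 1)) = \sum_(i < 5) Q i * t ^+ i.
  by rewrite dA mul1r mt !big_ord_recr big_ord0 /Q /= !hq; ring.
have [F3 F1 F2] := sds_deqs3 tA sA qQ.
have m10 : mact A (1, 0) = (1, 0) by rewrite /mact /A /=; congr pair; ring.
have m01 : mact A (0, 1) = (t0, 1) by rewrite /mact /A /=; congr pair; ring.
have m11 : mact A (1, 1) = (1 + t0, 1) by rewrite /mact /A /=; congr pair; ring.
have [hx hy hz] := tf.
have [] := tab_monic F3 F1 F2 (erefl _) l0.
- by rewrite /table /qcoef /mobius_act m10.
- rewrite /table /qcoef /mobius_act m10 m01 m11 !(hz (1, 0) (1, 0) (_, 1)) f1 /qcoef /= /t0 /table /qcoef f1.
  by field.
- rewrite /table /qcoef /mobius_act m10 m01 m11.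
  rewrite !(hy (1, 0) (1, 0) (_, 1)) f1 /qcoef /= /t0 e1 /table /qcoef f1.
  by field.
- rewrite /table /qcoef /mobius_act m10 m01 m11.
  rewrite !(hx (1, 0) (1, 0) (_, 1)) f1 /qcoef /= /t0 -e2 /table /qcoef f1.
  by field.
move=> s [s0]; set L := _ / _; rewrite /Q /= => q1 q0 fE.
exists t0, L, s; split=> //.
  move=> t; have := qQ t; rewrite dA mul1r mt => ->; rewrite !big_ord_recr big_ord0 /Q /= q1 q0 /L.
  by rewrite /Q /=; field.
pose B : K * K * (K * K) := ((0, - s), (1, 0)).
have dB : mdet B != 0 by rewrite /mdet /= mul0r sub0r mulr1 opprK.
have tB := triq_act B tA.
apply: (eqv_trans (g := mobius_act B (mobius_act A f))).
  by apply: (eqv_trans (eqv_act _ _) (eqv_act _ _)); rewrite // dA oner_neq0.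
apply: (eqv_scale tB (c := s ^- 4)) => [|x y z]; first by rewrite invr_eq0 expf_neq0.
have -> : mobius_act B (mobius_act A f) x y z = mobius_act B (tform (table (mobius_act A f))) x y z.
  exact: tableE tA _ _ _.
by rewrite fE; field.
Qed.

(** Otherwise the vanishing coefficients of the discriminants are, one after another, squares of
    single coefficients of f, until nothing is left to produce the coefficient (P 3)^2 of x^3 y^3.
    The result permits the normalization [a.<2,2,0> = 1]. *)
Lemma tab_isotropic_edge a P : deqs a P -> deqs (rot3 a) P -> deqs (rot3 (rot3 a)) P ->
  P 4%N = 0 -> P 3%N != 0 -> a.<2,2,2> = 0 -> a.<2,2,0> != 0.
Proof.
move=> E3 E1 E2 P4 P3 a0.
have e44 := E3 4 4 isT isT; have h44 := E2 4 4 isT isT; have g44 := E1 4 4 isT isT.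
have e42 := E3 4 2 isT isT; have h04 := E2 0 4 isT isT.
have e24 := E3 2 4 isT isT; have g40 := E1 4 0 isT isT.
have e33 := E3 3 3 isT isT.
rewrite /dcoef /conv2 /conv3 /rot3 /= P4 ?mul0r ?mulr0 in e44 h44 g44 e42 h04 e24 g40 e33.
rewrite a0 !(mul0r, mulr0, subr0) in e44 h44 g44.
move: e44 h44 g44 => /eqP; rewrite mulf_eq0 orbb => /eqP a221.
move=> /eqP; rewrite mulf_eq0 orbb => /eqP a212.
move=> /eqP; rewrite mulf_eq0 orbb => /eqP a122.
apply: contraNneq P3 => a220.
rewrite a0 ?a221 ?a212 ?a122 a220 ?(mul0r, mulr0, subr0, add0r, addr0) in e33 e42 h04 e24 g40.
move: e42 h04 e24 g40 => /eqP; rewrite mulf_eq0 orbb => /eqP a211.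
move=> /eqP; rewrite mulf_eq0 orbb => /eqP a210.
move=> /eqP; rewrite mulf_eq0 orbb => /eqP a121.
move=> /eqP; rewrite mulf_eq0 orbb => /eqP a120.
rewrite ?a211 ?a210 ?a121 ?a120 ?(mul0r, mulr0, subr0, add0r, addr0) in e33.
by move: e33 => /esym/eqP; rewrite mulf_eq0 orbb.
Qed.

Lemma tab_isotropic a P : deqs a P -> deqs (rot3 a) P -> deqs (rot3 (rot3 a)) P ->
  P 4%N = 0 -> P 3%N != 0 -> P 0%N = 0 -> a.<2,2,2> = 0 -> a.<2,2,0> = 1 ->
  forall x y z, tform a x y z = FW (P 2%N / P 3%N) (- (P 1%N / P 3%N)) x y z.
Proof.
move=> E3 E1 E2 P4 P3 P0 a0 a220.
have a202 : a.<2,0,2> != 0 := tab_isotropic_edge (a := rot3 (rot3 a)) E2 E3 E1 P4 P3 a0.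
have a022 : a.<0,2,2> != 0 := tab_isotropic_edge (a := rot3 a) E1 E2 E3 P4 P3 a0.
have e44 := E3 4 4 isT isT; have h44 := E2 4 4 isT isT; have g44 := E1 4 4 isT isT.
rewrite /dcoef /conv2 /conv3 /rot3 /= P4 a0 !(mul0r, mulr0, subr0) in e44 h44 g44.
move: e44 h44 g44 => /eqP; rewrite mulf_eq0 orbb => /eqP a221.
move=> /eqP; rewrite mulf_eq0 orbb => /eqP a212.
move=> /eqP; rewrite mulf_eq0 orbb => /eqP a122.
(* The coefficients of x^2 and y^2 will be the squares of y + b z + s and x + c z + u, and that of
   z^2 the square of y - x + v. *)
pose b := a.<2,1,1> / 2; pose c := a.<1,2,1> / 2; pose s := a.<2,1,0> / 2.
pose u := a.<1,2,0> / 2; pose v := a.<0,1,2> / 2.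
have a211 : a.<2,1,1> = 2 * b by rewrite /b; field.
have a121 : a.<1,2,1> = 2 * c by rewrite /c; field.
have a210 : a.<2,1,0> = 2 * s by rewrite /s; field.
have a120 : a.<1,2,0> = 2 * u by rewrite /u; field.
have a012 : a.<0,1,2> = 2 * v by rewrite /v; field.
have vals := (P4, P0, a0, a220, a221, a212, a122, a211, a121, a210, a120, a012).
have e42 := E3 4 2 isT isT; have h04 := E2 0 4 isT isT.
have h14 := E2 1 4 isT isT; have e24 := E3 2 4 isT isT.
have g40 := E1 4 0 isT isT; have g41 := E1 4 1 isT isT.
have h42 := E2 4 2 isT isT; have e33 := E3 3 3 isT isT.
have h33 := E2 3 3 isT isT; have g33 := E1 3 3 isT isT.
have h41 := E2 4 1 isT isT; have h40 := E2 4 0 isT isT.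
clearbody b c s u v.
rewrite /dcoef /conv2 /conv3 /rot3 /= !vals in e42 h04 h14 e24 g40 g41 h42 e33 h33 g33 h41 h40.
have a202E : a.<2,0,2> = b ^+ 2 by apply: (lincomb (lcM (- 4^-1) e42)); field.
have a200 : a.<2,0,0> = s ^+ 2 by apply: (lincomb (lcM (- 4^-1) h04)); field.
have a201 : a.<2,0,1> = 2 * s * b by apply: (lincomb (lcM (- 4^-1) h14)); field.
have a022E : a.<0,2,2> = c ^+ 2 by apply: (lincomb (lcM (- 4^-1) e24)); field.
have a020 : a.<0,2,0> = u ^+ 2 by apply: (lincomb (lcM (- 4^-1) g40)); field.
have a021 : a.<0,2,1> = 2 * u * c by apply: (lincomb (lcM (- 4^-1) g41)); field.
rewrite a202E a022E in a202 a022 h42 h33 g33 h41 h40.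
rewrite !sqrf_eq0 in a202 a022.
(* To leading order the coefficient of z^2 is the square of b x + c y or of b x - c y. The first
   leaves no term x^3 y^3 in the discriminant, against [P3]. *)
have a112 : a.<1,1,2> = - (2 * b * c).
  have /eqP : (a.<1,1,2> + 2 * b * c) * (a.<1,1,2> - 2 * b * c) = 0.
    by apply: (lincomb h42); ring.
  rewrite mulf_eq0 => /orP[] /eqP; first by move/addr0_eq => <-; rewrite opprK.
  move/subr0_eq => e; rewrite e in e33.
  case/eqP: P3; apply/eqP; rewrite -sqrf_eq0 expr2 -e33; apply/eqP; ring.
rewrite a112 in e33 h33 g33 h41.
have P32 : P 3%N ^+ 2 = 16 * (b * c) by apply: (lincomb (lcM (-1) e33)); ring.
(* The three discriminants give (P 3)^2 as 16 b c, - 16 b^2 c and - 16 b c^2. *)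
have bE : b = -1.
  apply: (lincomb (lcM ((16 * (b * c))^-1) (lcD e33 (lcM (-1) h33)))).
  by field; apply/andP.
have cE : c = -1.
  apply: (lincomb (lcM ((16 * (b * c))^-1) (lcD e33 (lcM (-1) g33)))).
  by field; apply/andP.
subst b c.
have a102 : a.<1,0,2> = - (2 * v) by apply: (lincomb (lcM (- 4^-1) h41)); field.
have a002 : a.<0,0,2> = v ^+ 2 by apply: (lincomb (lcM (- 4^-1) h40)); field.
have e32 := E3 3 2 isT isT; have e23 := E3 2 3 isT isT.
have h32 := E2 3 2 isT isT; have h23 := E2 2 3 isT isT.
have g32 := E1 3 2 isT isT; have g23 := E1 2 3 isT isT.
have e31 := E3 3 1 isT isT; have h31 := E2 3 1 isT isT; have g31 := E1 3 1 isT isT.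
have e30 := E3 3 0 isT isT; have h30 := E2 3 0 isT isT; have g30 := E1 3 0 isT isT.
have e20 := E3 2 0 isT isT.
have vals' := (vals, (a202E, a200, a201, a022E, a020, a021, a112, a102, a002)).
rewrite /dcoef /conv2 /conv3 /rot3 /= !vals' in e32 e23 h32 h23 g32 g23 e31 h31 g31 e30 h30 g30 e20.
(* The two equations of each pair have the same right-hand side. The differences of their left-hand
   sides, in the order e, g, h, are 16 times 2 s - 2 u + v, - s - 2 u - 2 v and 2 s + u - 2 v. The
   matrix of these forms is 3 times an orthogonal one, so its transpose inverts it up to 9, and 144
   is 16 times 9. *)
have s0 : s = 0.
  apply: (lincomb (lcM (144^-1) (lcD (lcM 2 (lcD e32 (lcM (-1) e23)))
    (lcD (lcM (-1) (lcD g32 (lcM (-1) g23))) (lcM 2 (lcD h32 (lcM (-1) h23))))))).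
  by field.
have u0 : u = 0.
  apply: (lincomb (lcM (144^-1) (lcD (lcM (-2) (lcD e32 (lcM (-1) e23)))
    (lcD (lcM (-2) (lcD g32 (lcM (-1) g23))) (lcD h32 (lcM (-1) h23)))))).
  by field.
have v0 : v = 0.
  apply: (lincomb (lcM (144^-1) (lcD (lcD e32 (lcM (-1) e23))
    (lcD (lcM (-2) (lcD g32 (lcM (-1) g23))) (lcM (-2) (lcD h32 (lcM (-1) h23))))))).
  by field.
subst s u v.
have P32' : P 3%N ^+ 2 = 16 by rewrite P32; ring.
have a111 : a.<1,1,1> = - (4 * (P 2%N / P 3%N)).
  by apply: (lincomb (lcD (lcM (- 4^-1) e32) (lcM (- (P 2%N / P 3%N / 4)) P32'))); field.
have g3 w : w = - (P 3%N * P 1%N / 8) -> w = - (2 * (P 1%N / P 3%N)).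
  by move=> ->; apply: (lincomb (lcM (- (P 1%N / P 3%N / 8)) P32')); field.
have a110 : a.<1,1,0> = - (2 * (P 1%N / P 3%N)).
  apply: g3; apply: (lincomb (lcM (- 8^-1) (lcD e31 (lcD g31 (lcM (-1) h31))))).
  by field.
have a101 : a.<1,0,1> = - (2 * (P 1%N / P 3%N)).
  apply: g3; apply: (lincomb (lcM (- 8^-1) (lcD e31 (lcD h31 (lcM (-1) g31))))).
  by field.
have a011 : a.<0,1,1> = - (2 * (P 1%N / P 3%N)).
  apply: g3; apply: (lincomb (lcM (- 8^-1) (lcD g31 (lcD h31 (lcM (-1) e31))))).
  by field.
have a100 : a.<1,0,0> = 0 by apply: (lincomb (lcM (- 4^-1) e30)); field.
have a010 : a.<0,1,0> = 0 by apply: (lincomb (lcM (- 4^-1) g30)); field.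
have a001 : a.<0,0,1> = 0 by apply: (lincomb (lcM (- 4^-1) h30)); field.
have a000 : a.<0,0,0> = (P 1%N / P 3%N) ^+ 2.
  rewrite a101 in e20.
  by apply: (lincomb (lcM (- 4^-1) e20)); field.
move=> x y z; rewrite /tform !big_ord_recr !big_ord0 /= !vals'.
by rewrite a111 a110 a101 a011 a100 a010 a001 a000 /FW; ring.
Qed.

Lemma cubic_isotropic f q (L s l : K) : triq f -> sds f q -> l != 0 ->
  (forall t, q (t, 1) = l * (t * (t ^+ 2 + L * t - s))) ->
  f (1, 0) (1, 0) (1, 0) = 0 -> eqv f (FW L s).
Proof.
move=> tf sf l0 hq f0.
pose P n := nth 0 [:: 0; - (l * s); l * L; l; 0] n.
have qP t : q (t, 1) = \sum_(i < 5) P i * t ^+ i.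
  by rewrite hq !big_ord_recr big_ord0 /P /=; ring.
have [E3 E1 E2] := sds_deqs3 tf sf qP.
have := tab_isotropic_edge E3 E1 E2 (erefl _) l0 f0.
set c := _.<2,2,0> => c0.
pose f' x y z := c^-1 * f x y z.
have tf' : triq f' by apply: triq_scale.
have sf' := sds_scale c^-1 sf.
pose Q n := c^-1 * P n.
have qQ t : c^-1 * q (t, 1) = \sum_(i < 5) Q i * t ^+ i.
  by rewrite qP mulr_sumr; apply: eq_bigr => i _; rewrite mulrA.
have [F3 F1 F2] := sds_deqs3 tf' sf' qQ.
have Q3 : Q 3%N != 0 by rewrite mulf_neq0 ?invr_eq0.
have := tab_isotropic F3 F1 F2 _ Q3.
rewrite /Q /= !mulr0 => /(_ erefl erefl) h.
apply: (eqv_scale tf (c := c^-1)); first by rewrite invr_eq0.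
move=> x y z; rewrite -/(f' x y z) (tableE tf') h.
- by congr (FW _ _ x y z); rewrite /P /=; field; apply/andP.
- by rewrite /table /qcoef /f' f0 mulr0.
- by rewrite -[RHS](mulVf c0) /c /table /qcoef /f'; ring.
Qed.

(** * From [FW] to the canonical forms A, B and D *)

Lemma eq_qform q q' : q =1 q' -> qform q -> qform q'.
Proof. by move=> e h z; rewrite /qcoef -!e h. Qed.

Lemma eqv_triq f g : eqv f g -> triq f -> triq g.
Proof.
move=> [A _ h] /(triq_act A) [hx hy hz].
by split=> u v; [apply: eq_qform (hx u v)|apply: eq_qform (hy u v)|apply: eq_qform (hz u v)]
  => w /=; rewrite h.
Qed.

(** The target is a function of scalars, because the listed polynomials are known through their
    values. *)
Definition eqva f (h : K -> K -> K -> K) : Prop :=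
  exists2 A, mdet A != 0 & forall x y z : K, h x y z = mobius_act A f (x, 1) (y, 1) (z, 1).

Lemma eqva_affine f h :
  (forall x y z : K, h x y z = f (x, 1) (y, 1) (z, 1)) -> eqva f h.
Proof.
move=> hE; exists ((1, 0), (0, 1)); first by rewrite /mdet /= mulr0 subr0 mulr1 oner_eq0.
by move=> x y z; rewrite hE /mobius_act /mact /=; congr f; congr pair; ring.
Qed.

Lemma eqv_eqva f g h : eqv f g -> eqva g h -> eqva f h.
Proof.
move=> efg [A dA hA].
have [B dB hB] := eqv_trans efg (eqv_act g dA).
by exists B => // x y z; rewrite hA -hB.
Qed.

Lemma eqva_scale c A f h : triq f -> c != 0 -> mdet A != 0 ->
  (forall x y z : K, h x y z = c * mobius_act A f (x, 1) (y, 1) (z, 1)) -> eqva f h.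
Proof.
move=> tf c0 dA hh; have tA := triq_act A tf.
have [B dB hB] := eqv_trans (eqv_act f dA)
  (@eqv_scale c _ (fun x y z => c * mobius_act A f x y z) tA c0 (fun _ _ _ => erefl)).
by exists B => // x y z; rewrite hh hB.
Qed.

Definition FAv (k x y z : K) : K :=
  2^-1 * (- (k ^+ 2 * x ^+ 2) - k ^+ 2 * y ^+ 2 + 1 + k ^+ 2 * (x ^+ 2 * y ^+ 2))
    * z ^+ 2 + (1 - k ^+ 2) * (x * y * z)
  + 2^-1 * (x ^+ 2 + y ^+ 2 - k ^+ 2 * (x ^+ 2 * y ^+ 2) - 1).

Lemma FW_FAv (w k : K) : w != 0 -> 1 - k ^+ 2 != 0 ->
  let L := - (2 * w * (1 + k ^+ 2) / (1 - k ^+ 2)) in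
  triq (FW L (- w ^+ 2)) -> eqva (FW L (- w ^+ 2)) (FAv k).
Proof.
move=> w0 k1 L tF.
apply: (eqva_scale (c := (1 - k ^+ 2) / (32 * w ^+ 4)) (A := ((w, - w), (1, 1))) tF).
- by rewrite mulf_neq0 // invr_eq0 mulf_neq0 ?pnatr_eq0 ?expf_neq0.
- by rewrite /mdet /= mulr1 mulr1 opprK -mulr2n -mulr_natl mulf_neq0 ?nz2.
- by move=> x y z; rewrite /mobius_act /mact /FW /FAv /L /=; field; apply/andP.
Qed.

Lemma FW_A (r1 r2 : K) : r1 != 0 -> r2 != 0 -> r1 != r2 ->
  triq (FW (- (r1 + r2)) (- (r1 * r2))) ->
  exists k, [/\ k ^+ 2 != 0, k ^+ 2 != 1 & eqva (FW (- (r1 + r2)) (- (r1 * r2))) (FAv k)].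
Proof.
move=> h1 h2 h12 tF; pose w := sqrtC (r1 * r2).
have w2 : w ^+ 2 = r1 * r2 by rewrite sqrtCK.
have w0 : w != 0 by rewrite -sqrf_eq0 w2 mulf_neq0.
have wp : w + r1 != 0.
  apply: contra_neq h12 => /eqP; rewrite addr_eq0 => /eqP e.
  by apply: (mulfI h1); rewrite -w2 e sqrrN.
have wm : w - r1 != 0.
  apply: contra_neq h12 => /subr0_eq e.
  by apply: (mulfI h1); rewrite -w2 e.
(* The solution of w (1/k - 1) / (1/k + 1) = r1. *)
pose k := (w - r1) / (w + r1).
have k1E : 1 - k ^+ 2 = 4 * w * r1 / (w + r1) ^+ 2 by rewrite /k; field.
have k1 : 1 - k ^+ 2 != 0.
  by rewrite k1E mulf_neq0 ?invr_eq0 ?expf_neq0 // !mulf_neq0 ?nz4.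
exists k; split.
- by rewrite expf_neq0 // mulf_neq0 ?invr_eq0.
- by rewrite eq_sym -subr_eq0.
- have r2E : r2 = w ^+ 2 / r1 by rewrite w2; field.
  have LE : - (r1 + r2) = - (2 * w * (1 + k ^+ 2) / (1 - k ^+ 2)).
    by rewrite k1E r2E /k; field; rewrite wp h1 w0.
  by move: tF; rewrite -w2 LE; apply: FW_FAv.
Qed.

Definition FBv (e x y z : K) : K :=
  x * y * z + e / 2 * (x ^+ 2 + y ^+ 2 + z ^+ 2 - e ^+ 2).

(** The limit k = 0 of type A, where 1/k and - 1/k meet at infinity; [FAv 0] coincides with
    [FBv 1]. *)
Lemma FW_B (r : K) : r != 0 -> triq (FW (- (r + r)) (- (r * r))) ->
  eqva (FW (- (r + r)) (- (r * r))) (FBv 1).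
Proof.
move=> r0; have LE : - (r + r) = - (2 * r * (1 + 0 ^+ 2) / (1 - 0 ^+ 2)) by field.
rewrite -expr2 LE => tF.
have k1 : 1 - 0 ^+ 2 != 0 :> K by rewrite expr0n subr0 oner_eq0.
have [A dA hA] := FW_FAv r0 k1 tF.
by exists A => // x y z; rewrite -hA /FBv /FAv; field.
Qed.

Definition FDv (x y z : K) : K :=
  - (2^-1 * (x * y + y * z + x * z)) + 4^-1 * (x ^+ 2 + y ^+ 2 + z ^+ 2).

(** Inversion exchanges the triple zero 0 of t^3 with its simple zero at infinity, as the canonical
    form requires. *)
Lemma FW_D : triq (FW 0 0) -> eqva (FW 0 0) FDv.
Proof.
move=> tF; apply: (eqva_scale (c := 4^-1) (A := ((0, 1), (1, 0))) tF).
- by rewrite invr_eq0 nz4.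
- by rewrite /mdet /= mul0r mulr1 sub0r oppr_eq0 oner_eq0.
- by move=> x y z; rewrite /mobius_act /mact /FW /FDv /=; field.
Qed.

(** The zero moved to 0 may be 0, r1 or r2, depending on f; u and v are the positions of the other
    two relative to it. In the last two cases they are non-zero because s = - u v is. *)
Lemma cubic f q (r1 r2 l : K) : triq f -> sds f q -> l != 0 ->
  (forall t, q (t, 1) = l * (t * (t - r1) * (t - r2))) ->
  exists u v, eqv f (FW (- (u + v)) (- (u * v))) /\
    [\/ u = r1 /\ v = r2, 
        [/\ u = - r1, v = r2 - r1, u != 0 & v != 0] |
        [/\ u = - r2, v = r1 - r2, u != 0 & v != 0]].
Proof.
move=> tf sf l0 hq; have [f0|f0] := eqVneq (f (1, 0) (1, 0) (1, 0)) 0.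
  exists r1, r2; split; last by apply: Or31.
  by apply: (cubic_isotropic tf sf l0) => // t; rewrite hq; ring.
set c := f _ _ _ in f0.
have c'0 : c^-1 != 0 by rewrite invr_eq0.
pose f' x y z := c^-1 * f x y z.
have tf' : triq f' := triq_scale c^-1 tf.
have ef : eqv f f' by apply: (eqv_scale tf c'0).
have [|||t0 [L [s [s0 hE eL]]]] := @cubic_monic f' (fun x => c^-1 * q x)
    (- (c^-1 * l * (r1 + r2))) (c^-1 * l * (r1 * r2)) 0 (c^-1 * l) tf' (sds_scale _ sf).
- by rewrite mulf_neq0.
- by move=> t; rewrite hq; ring.
- by rewrite /f' mulVf.
have cl : c^-1 * l != 0 by rewrite mulf_neq0.
have hE' t : (t + t0) * (t + t0 - r1) * (t + t0 - r2) = t * (t ^+ 2 + L * t - s).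
  by apply: (mulfI cl); rewrite -hE hq; ring.
(* The value at 0 shows that [t0] is one of the three zeros; those at 1 and -1 then determine L and
   s. *)
have e0 := hE' 0; have e1 := hE' 1; have em := hE' (-1).
have [] : exists u v, [/\ L = - (u + v), s = - (u * v) & 
    [\/ u = r1 /\ v = r2, u = - r1 /\ v = r2 - r1 | u = - r2 /\ v = r1 - r2]].
  have LS u v : (forall t, (t + t0) * (t + t0 - r1) * (t + t0 - r2) = t * (t - u) * (t - v)) ->
      L = - (u + v) /\ s = - (u * v).
    move=> h; rewrite h in e1; rewrite h in em; split.
      by apply: (lincomb (lcM (- 2^-1) (lcD e1 em))); field.
    by apply: (lincomb (lcM (2^-1) (lcD e1 (lcM (-1) em)))); field.
  move: e0; rewrite mul0r add0r => /eqP; rewrite !mulf_eq0 !subr_eq0.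
  case/orP=> [/orP[]|] /eqP t0E.
  - have [] := LS r1 r2 => [t|-> ->]; first by rewrite t0E addr0.
    by exists r1, r2; split=> //; apply: Or31.
  - have [] := LS (- r1) (r2 - r1) => [t|-> ->]; first by rewrite t0E; ring.
    by exists (- r1), (r2 - r1); split=> //; apply: Or32.
  - have [] := LS (- r2) (r1 - r2) => [t|-> ->]; first by rewrite t0E; ring.
    by exists (- r2), (r1 - r2); split=> //; apply: Or33.
move=> u [v [LE sE uv]]; exists u, v.
split; first by rewrite -LE -sE; apply: eqv_trans eL.
move: s0; rewrite sE oppr_eq0 mulf_eq0 negb_or => /andP[u0 v0].
by case: uv => -[-> ->] in u0 v0 *; [apply: Or31|apply: Or32|apply: Or33].
Qed.

(** * Two double zeros *)

Definition FCh (l m n : K) (x y z : V) : K :=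
  l * (x.1 ^+ 2 * y.1 ^+ 2 * z.1 ^+ 2) + m * (x.1 * x.2 * y.1 * y.2 * z.1 * z.2)
  + n * (x.2 ^+ 2 * y.2 ^+ 2 * z.2 ^+ 2).

(** With n = [a.<0,0,0>], f equals B^2 + n - k^2 for B = x y z + c x y + b x z + d y z + s1 x + s2 y
    + s3 z + k. Its discriminant in z is 4 (k^2 - n) (x y + b x + d y + s3)^2, a non-zero multiple
    of x^2 y^2 only for b = d = s3 = 0; the other two variables give c = s1 = s2 = 0. *)
Lemma tab_toric a (p : K) (P := nth 0 [:: 0; 0; p; 0; 0]) :
  deqs a P -> deqs (rot3 a) P -> deqs (rot3 (rot3 a)) P -> p != 0 -> a.<2,2,2> = 1 ->
  exists2 k, p ^+ 2 = 4 * (k ^+ 2 - a.<0,0,0>) &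
    forall x y z, tform a x y z = FCh 1 (2 * k) a.<0,0,0> x y z.
Proof.
move=> E3 E1 E2 p0 a1.
have P4 : P 4%N = 0 by [].
have [] := face_square E3 E2 P4 a1.
have [] := face_square (a := rot3 a) E1 E3 P4 a1.
have [] := face_square (a := rot3 (rot3 a)) E2 E1 P4 a1.
rewrite /rot3.
set u := a.<2,2,1>; set v := a.<2,1,2>; set w := a.<1,2,2>.
pose c := u / 2; pose b := v / 2; pose d := w / 2.
have uE : u = 2 * c by rewrite /c; field.
have vE : v = 2 * b by rewrite /b; field.
have wE : w = 2 * d by rewrite /d; field.
rewrite -/c -/b -/d.
set s1 := a.<2,1,1> / 2 - _; set s2 := a.<1,2,1> / 2 - _; set s3 := a.<1,1,2> / 2 - _.
have a211 : a.<2,1,1> = 2 * (s1 + c * b) by rewrite /s1; field.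
have a121 : a.<1,2,1> = 2 * (s2 + d * c) by rewrite /s2; field.
have a112 : a.<1,1,2> = 2 * (s3 + b * d) by rewrite /s3; field.
move=> _ _ [a102 a012 a002] a022 _ [a021 a120 a020] a220 a202 [a210 a201 a200].
pose k := a.<1,1,1> / 2 - c * s3 - b * s2 - d * s1.
have a111 : a.<1,1,1> = 2 * (k + c * s3 + b * s2 + d * s1) by rewrite /k; field.
rewrite vE in a102 a201; rewrite wE in a012 a021; rewrite uE in a120 a210.
rewrite /u in uE; rewrite /v in vE; rewrite /w in wE.
clearbody k s1 s2 s3 c b d.
have vals := (a1, uE, vE, wE, a211, a121, a112, a102, a012, a002, a022, a021, a120, a020,
  a220, a202, a210, a201, a200, a111).
have e33 := E3 3 3 isT isT; have h33 := E2 3 3 isT isT; have g33 := E1 3 3 isT isT.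
have e32 := E3 3 2 isT isT; have e23 := E3 2 3 isT isT; have h32 := E2 3 2 isT isT.
have e22 := E3 2 2 isT isT.
have e21 := E3 2 1 isT isT; have e12 := E3 1 2 isT isT; have h12 := E2 1 2 isT isT.
have e11 := E3 1 1 isT isT; have h11 := E2 1 1 isT isT; have g11 := E1 1 1 isT isT.
rewrite /P /dcoef /conv2 /conv3 /rot3 /= !vals !(mulr0, mul0r)
  in e33 h33 g33 e32 e23 h32 e22 e21 e12 h12 e11 h11 g11.
have a110 : a.<1,1,0> = 2 * (c * k + s1 * s2).
  by apply: (lincomb (lcM (- 4^-1) e33)); field.
have a101 : a.<1,0,1> = 2 * (b * k + s1 * s3).
  by apply: (lincomb (lcM (- 4^-1) h33)); field.
have a011 : a.<0,1,1> = 2 * (d * k + s2 * s3).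
  by apply: (lincomb (lcM (- 4^-1) g33)); field.
rewrite !(a110, a101, a011) in e32 e23 h32 e22 e21 e12 h12 e11 h11 g11.
have a100 : a.<1,0,0> = 2 * s1 * k by apply: (lincomb (lcM (- 4^-1) e32)); field.
have a010 : a.<0,1,0> = 2 * s2 * k by apply: (lincomb (lcM (- 4^-1) e23)); field.
have a001 : a.<0,0,1> = 2 * s3 * k by apply: (lincomb (lcM (- 4^-1) h32)); field.
rewrite !(a100, a010, a001) in e22 e21 e12 h12 e11 h11 g11.
have p2 : p ^+ 2 = 4 * (k ^+ 2 - a.<0,0,0>) by apply: (lincomb (lcM (-1) e22)); ring.
have z (r e : K) : e = 0 -> e = 8 * r * (k ^+ 2 - a.<0,0,0>) -> r = 0.
  move=> e0 eE; have /eqP : r * p ^+ 2 = 0 by rewrite p2 -[RHS](mulr0 2^-1) -e0 eE; field.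
  by rewrite mulf_eq0 sqrf_eq0 (negPf p0) orbF => /eqP.
have b0 : b = 0 by apply: z e21 _; ring.
have d0 : d = 0 by apply: z e12 _; ring.
have c0 : c = 0 by apply: z h12 _; ring.
subst b c d.
have s30 : s3 = 0 by apply: z e11 _; ring.
have s20 : s2 = 0 by apply: z h11 _; ring.
have s10 : s1 = 0 by apply: z g11 _; ring.
subst s1 s2 s3.
exists k => // x y t; rewrite /tform !big_ord_recr !big_ord0 /= !vals.
by rewrite a110 a101 a011 a100 a010 a001 /FCh; ring.
Qed.

Lemma toric_corner f : triq f -> sds f (fun x => x.1 ^+ 2 * x.2 ^+ 2) ->
  f (1, 0) (1, 0) (1, 0) != 0 ->
  exists l m n, m ^+ 2 - 4 * l * n = 1 /\ forall x y z, f x y z = FCh l m n x y z.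
Proof.
move=> tf sf; set c := f _ _ _ => c0.
have c'0 : c^-1 != 0 by rewrite invr_eq0.
pose f' x y z := c^-1 * f x y z.
have tf' : triq f' := triq_scale c^-1 tf.
have sf' := sds_scale c^-1 sf.
pose P n := nth 0 [:: 0; 0; c^-1; 0; 0] n.
pose Q x : K := c^-1 * (x.1 ^+ 2 * x.2 ^+ 2).
have qP (t : K) : Q (t, 1) = \sum_(i < 5) P i * t ^+ i.
  by rewrite /Q !big_ord_recr big_ord0 /P /=; ring.
have [E3 E1 E2] := sds_deqs3 tf' sf' qP.
have [|k kE fE] := tab_toric E3 E1 E2 c'0; first by rewrite /table /qcoef /f' mulVf.
set n := table _ _ _ _ in kE fE.
exists c, (c * (2 * k)), (c * n); split.
  by apply: (lincomb (lcM (- c ^+ 2) kE)); field.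
move=> x y z; have -> : f x y z = c * f' x y z by rewrite /f' mulVKf.
by rewrite (tableE tf') fE /FCh; ring.
Qed.

Definition swp (b : bool) x : V := if b then (x.2, x.1) else x.

Lemma swpK b : involutive (swp b).
Proof. by case: b => -[]. Qed.

(** Inverting the variables separately is no gauge transformation; it only serves to read off the
    shape of f and is undone afterwards. *)
Definition flip (b1 b2 b3 : bool) f x y z : K := f (swp b1 x) (swp b2 y) (swp b3 z).

Lemma qform_swp b q : qform q -> qform (fun x => q (swp b x)).
Proof. by case: b => // h [u v]; rewrite /swp /= h /qcoef /=; ring. Qed.

Lemma disc_swp b q : qdisc (fun x => q (swp b x)) = qdisc q.
Proof. by case: b => //; rewrite /qdisc /qcoef /swp /=; ring. Qed.

Lemma triq_flip b1 b2 b3 f : triq f -> triq (flip b1 b2 b3 f).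
Proof.
case=> hx hy hz; split=> u v; rewrite /flip.
- exact: (@qform_swp b1 (fun x => f x _ _)).
- exact: (@qform_swp b2 (fun y => f _ y _)).
- exact: (@qform_swp b3 (fun z => f _ _ z)).
Qed.

Lemma sds_flip b1 b2 b3 f : sds f (fun x => x.1 ^+ 2 * x.2 ^+ 2) ->
  sds (flip b1 b2 b3 f) (fun x => x.1 ^+ 2 * x.2 ^+ 2).
Proof.
have sQ b x : (swp b x).1 ^+ 2 * (swp b x).2 ^+ 2 = x.1 ^+ 2 * x.2 ^+ 2.
  by case: b => //=; rewrite mulrC.
move=> h x y; rewrite /flip; split.
- rewrite (@disc_swp b1 (fun z => f z _ _)).
  by have [-> _ _] := h (swp b2 x) (swp b3 y); rewrite !sQ.
- rewrite (@disc_swp b2 (fun z => f _ z _)).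
  by have [_ -> _] := h (swp b3 x) (swp b1 y); rewrite !sQ.
- rewrite (@disc_swp b3 (fun z => f _ _ z)).
  by have [_ _ ->] := h (swp b1 x) (swp b2 y); rewrite !sQ.
Qed.

(** The coefficients form a cube of side 3. Once its corners vanish, vanishing squares remove the
    middle of each edge and then the centre of each face; only the centre of the cube, the term x y
    z, survives. *)
Lemma tab_corners0 a (P := nth 0 [:: 0; 0; 1; 0; 0]) :
  deqs a P -> deqs (rot3 a) P -> deqs (rot3 (rot3 a)) P ->
  (forall b1 b2 b3 : bool, a (b1.*2) (b2.*2) (b3.*2) = 0) ->
  exists2 m, m ^+ 2 = 1 & forall x y z, tform a x y z = FCh 0 m 0 x y z.
Proof.
move=> E3 E1 E2 h.
have sq (u : K) : u * u = 0 -> u = 0.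
  by move=> /eqP; rewrite mulf_eq0 orbb => /eqP.
have sq4 (u : K) : u * u - 4 * (0 * 0) = 0 * 0 -> u = 0.
  by rewrite !mulr0 subr0 => /sq.
have h0 := h false false false; have h1 := h false false true.
have h2 := h false true false; have h3 := h false true true.
have h4 := h true false false; have h5 := h true false true.
have h6 := h true true false; have h7 := h true true true.
rewrite /= in h0 h1 h2 h3 h4 h5 h6 h7.
have corners := (h0, h1, h2, h3, h4, h5, h6, h7).
have e44 := E3 4 4 isT isT; have e40 := E3 4 0 isT isT.
have e04 := E3 0 4 isT isT; have e00 := E3 0 0 isT isT.
have f44 := E2 4 4 isT isT; have f40 := E2 4 0 isT isT.
have f04 := E2 0 4 isT isT; have f00 := E2 0 0 isT isT.
have g44 := E1 4 4 isT isT; have g40 := E1 4 0 isT isT.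
have g04 := E1 0 4 isT isT; have g00 := E1 0 0 isT isT.
rewrite /P /dcoef /conv2 /conv3 /rot3 /= ?corners
  in e44 e40 e04 e00 f44 f40 f04 f00 g44 g40 g04 g00.
have edges := (sq4 _ e44, sq4 _ e40, sq4 _ e04, sq4 _ e00, sq4 _ f44, sq4 _ f40,
  sq4 _ f04, sq4 _ f00, sq4 _ g44, sq4 _ g40, sq4 _ g04, sq4 _ g00).
have e42 := E3 4 2 isT isT; have e02 := E3 0 2 isT isT.
have e24 := E3 2 4 isT isT; have e20 := E3 2 0 isT isT.
have f42 := E2 4 2 isT isT; have f02 := E2 0 2 isT isT.
have e22 := E3 2 2 isT isT.
rewrite /P /dcoef /conv2 /conv3 /rot3 /= !corners ?edges in e42 e02 e24 e20 f42 f02 e22.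
have a211 : a.<2,1,1> = 0 by apply: sq; apply: (lincomb e42); ring.
have a011 : a.<0,1,1> = 0 by apply: sq; apply: (lincomb e02); ring.
have a121 : a.<1,2,1> = 0 by apply: sq; apply: (lincomb e24); ring.
have a101 : a.<1,0,1> = 0 by apply: sq; apply: (lincomb e20); ring.
have a112 : a.<1,1,2> = 0 by apply: sq; apply: (lincomb f42); ring.
have a110 : a.<1,1,0> = 0 by apply: sq; apply: (lincomb f02); ring.
rewrite a211 a011 a121 a101 a112 a110 in e22.
exists a.<1,1,1>; first by apply: (lincomb e22); ring.
move=> x y z; rewrite /tform !big_ord_recr !big_ord0 /=.
by rewrite !corners !edges a211 a011 a121 a101 a112 a110 /FCh; ring.
Qed.

Definition FCv1 (l m n x y z : K) : K :=
  l * (x ^+ 2 * y ^+ 2) + m * (x * y * z) + n * z ^+ 2.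
Definition FCv2 (l m n x y z : K) : K :=
  l * (x ^+ 2 * z ^+ 2) + m * (x * y * z) + n * y ^+ 2.
Definition FCv3 (l m n x y z : K) : K :=
  l * (y ^+ 2 * z ^+ 2) + m * (x * y * z) + n * x ^+ 2.
Definition FCv4 (l m n x y z : K) : K :=
  l * (x ^+ 2 * y ^+ 2 * z ^+ 2) + m * (x * y * z) + n.

Lemma toric f : triq f -> sds f (fun x => x.1 ^+ 2 * x.2 ^+ 2) ->
  exists l m n, m ^+ 2 - 4 * l * n = 1 /\
  [\/ eqva f (FCv1 l m n), eqva f (FCv2 l m n), eqva f (FCv3 l m n)
    | eqva f (FCv4 l m n)].
Proof.
move=> tf sf.
pose pt b : V := swp b (1, 0).
case: (boolP [forall b1, forall b2, forall b3, f (pt b1) (pt b2) (pt b3) == 0]).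
  move=> /forallP h0; pose P n : K := nth 0 [:: 0; 0; 1; 0; 0] n.
  pose Q x : K := x.1 ^+ 2 * x.2 ^+ 2.
  have qP (t : K) : Q (t, 1) = \sum_(i < 5) P i * t ^+ i.
    by rewrite /Q !big_ord_recr big_ord0 /P /=; ring.
  have [E3 E1 E2] := sds_deqs3 tf sf qP.
  have [|m m2 fE] := tab_corners0 E3 E1 E2.
    move=> b1 b2 b3.
    (* [pt false] is the point at infinity and selects exponent 2, whereas [b.*2] is 2 for
       [true]. *)
    have := h0 (~~ b1) => /forallP/(_ (~~ b2))/forallP/(_ (~~ b3))/eqP.
    by case: b1; case: b2; case: b3.
  exists 0, m, 0; rewrite !mulr0 subr0; split=> //; apply: Or44; apply: eqva_affine => x y z.
  by rewrite (tableE tf) fE /FCh /FCv4 /=; ring.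
rewrite negb_forall => /existsP[b1]; rewrite negb_forall => /existsP[b2].
rewrite negb_forall => /existsP[b3] fn0.
have [l [m [n [e fE]]]] := toric_corner (triq_flip b1 b2 b3 tf) (sds_flip b1 b2 b3 sf) fn0.
have {}fE x y z : f x y z = FCh l m n (swp b1 x) (swp b2 y) (swp b3 z).
  by rewrite -fE /flip !swpK.
have e' : m ^+ 2 - 4 * n * l = 1 by rewrite -[RHS]e; ring.
(* Opposite corners give the same family with l and n exchanged. *)
move: b1 b2 b3 fE {fn0} => [] [] [] fE.
- exists n, m, l; split=> //; apply: Or44; apply: eqva_affine => x y z.
  by rewrite fE /FCh /FCv4 /=; ring.
- exists n, m, l; split=> //; apply: Or41; apply: eqva_affine => x y z.
  by rewrite fE /FCh /FCv1 /=; ring.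
- exists n, m, l; split=> //; apply: Or42; apply: eqva_affine => x y z.
  by rewrite fE /FCh /FCv2 /=; ring.
- exists l, m, n; split=> //; apply: Or43; apply: eqva_affine => x y z.
  by rewrite fE /FCh /FCv3 /=; ring.
- exists n, m, l; split=> //; apply: Or43; apply: eqva_affine => x y z.
  by rewrite fE /FCh /FCv3 /=; ring.
- exists l, m, n; split=> //; apply: Or42; apply: eqva_affine => x y z.
  by rewrite fE /FCh /FCv2 /=; ring.
- exists l, m, n; split=> //; apply: Or41; apply: eqva_affine => x y z.
  by rewrite fE /FCh /FCv1 /=; ring.
- exists l, m, n; split=> //; apply: Or44; apply: eqva_affine => x y z.
  by rewrite fE /FCh /FCv4 /=; ring.
Qed.

(** * A quadruple zero at infinity *)

(* If the corner coefficient were non-zero, g would be the square of a bilinear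
   form, and both discriminants would vanish. *)
Lemma biquad_lead0 (g : V -> V -> K) :
  (forall y, qform (fun x => g x y)) -> (forall x, qform (g x)) ->
  (forall x, qdisc (g x) = x.2 ^+ 4) -> (forall y, qdisc (fun x => g x y) = y.2 ^+ 4) ->
  g (1, 0) (1, 0) = 0.
Proof.
move=> hx hy dy dx; pose c i j := qcoef i (fun x => qcoef j (g x)).
have gy x k : (k < 3)%N -> qcoef k (g x) =
    c 2%N k * x.1 ^+ 2 + c 1%N k * (x.1 * x.2) + c 0%N k * x.2 ^+ 2.
  case: k => [|[|[|]]] //= _.
  - exact: hx.
  - by rewrite (hx (1, 1) x) (hx (1, 0) x) (hx (0, 1) x) /c /qcoef; ring.
  - exact: hx.
have gx y k : (k < 3)%N -> qcoef k (fun x => g x y) =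
    c k 2%N * y.1 ^+ 2 + c k 1%N * (y.1 * y.2) + c k 0%N * y.2 ^+ 2.
  case: k => [|[|[|]]] //= _.
  - exact: hy.
  - by rewrite (hy (1, 1) y) (hy (1, 0) y) (hy (0, 1) y) /c /qcoef; ring.
  - exact: hy.
have quart (u v w : nat -> K) : (forall t : K,
    (u 2%N * t ^+ 2 + u 1%N * t + u 0%N) ^+ 2 -
    4 * (v 2%N * t ^+ 2 + v 1%N * t + v 0%N) * (w 2%N * t ^+ 2 + w 1%N * t + w 0%N) = 1) ->
  forall n, (n < 5)%N -> conv3 *%R u u n - 4 * conv3 *%R v w n - (n == 0)%:R = 0.
  move=> h n hn; pose d i := conv3 *%R u u i - 4 * conv3 *%R v w i - (i == 0)%:R.
  have /pow_sum_eq0/(_ n) : forall t, \sum_(i < 5) d i * t ^+ i = 0.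
    move=> t; apply: (lincomb (h t)).
    by rewrite !big_ord_recr big_ord0 /d /conv3 /=; ring.
  by rewrite (big_pred1 (Ordinal hn)) // => k; rewrite -val_eqE.
have hY t : (c 2%N 1%N * t ^+ 2 + c 1%N 1%N * t + c 0%N 1%N) ^+ 2 -
     4 * (c 2%N 2%N * t ^+ 2 + c 1%N 2%N * t + c 0%N 2%N) *
     (c 2%N 0%N * t ^+ 2 + c 1%N 0%N * t + c 0%N 0%N) = 1.
  by have := dy (t, 1); rewrite /qdisc !gy //= !expr1n => e; rewrite -[RHS]e; ring.
have hX t : (c 1%N 2%N * t ^+ 2 + c 1%N 1%N * t + c 1%N 0%N) ^+ 2 -
     4 * (c 2%N 2%N * t ^+ 2 + c 2%N 1%N * t + c 2%N 0%N) *
     (c 0%N 2%N * t ^+ 2 + c 0%N 1%N * t + c 0%N 0%N) = 1.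
  by have := dx (t, 1); rewrite /qdisc !gx //= !expr1n => e; rewrite -[RHS]e; ring.
have Y := quart (c^~ 1%N) (c^~ 2%N) (c^~ 0%N) hY.
have X := quart (c 1%N) (c 2%N) (c 0%N) hX.
have y4 := Y 4%N isT; have y3 := Y 3%N isT; have y2 := Y 2%N isT.
have y0 := Y 0%N isT; have x4 := X 4%N isT; have x3 := X 3%N isT.
rewrite -[g _ _]/(c 2%N 2%N); clearbody c.
apply/eqP/negPn/negP.
rewrite /conv3 /= ?subr0 in y4 y3 y2 y0 x4 x3.
set w := c 2%N 2%N in y4 y3 y2 x4 x3 * => w0.
have w4 : 4 * w != 0 by rewrite mulf_neq0 ?nz4.
have c20 : c 2%N 0%N = c 2%N 1%N ^+ 2 / (4 * w).
  by apply: (lincomb (lcM (- (4 * w)^-1) y4)); field.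
have c02 : c 0%N 2%N = c 1%N 2%N ^+ 2 / (4 * w).
  by apply: (lincomb (lcM (- (4 * w)^-1) x4)); field.
rewrite c20 c02 in y3 y2 y0 x3.
have c10 : c 1%N 0%N = (2 * c 1%N 1%N * c 2%N 1%N - c 1%N 2%N * c 2%N 1%N ^+ 2 / w) / (4 * w).
  by apply: (lincomb (lcM (- (4 * w)^-1) y3)); field.
have c01 : c 0%N 1%N = (2 * c 1%N 1%N * c 1%N 2%N - c 2%N 1%N * c 1%N 2%N ^+ 2 / w) / (4 * w).
  by apply: (lincomb (lcM (- (4 * w)^-1) x3)); field.
rewrite c10 c01 in y2 y0.
have c00 : c 0%N 0%N = (c 1%N 1%N - c 2%N 1%N * c 1%N 2%N / (2 * w)) ^+ 2 / (4 * w).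
  by apply: (lincomb (lcM (- (4 * w)^-1) y2)); field.
rewrite c00 in y0.
have /eqP := oner_eq0 K; case; apply: (lincomb (lcM (-1) y0)); by field.
Qed.

Definition FEv (l m n : K) (u : K) : K := l * u ^+ 2 + m * u + n.

(** With the terms in x^2 y^2 and x^2 z^2 gone, the coefficients of x^4 in the discriminants are
    squares of the remaining non-constant coefficients of x^2, and P has no term of positive
    degree. *)
Lemma tab_lead a : (forall k, (k < 3)%N -> a 2%N 2%N k = 0) ->
  (forall k, (k < 3)%N -> a 2%N k 2%N = 0) ->
  forall (P := nth 0 [:: 1; 0; 0; 0; 0]), deqs a P -> deqs (rot3 (rot3 a)) P ->
  [/\ a.<2,1,1> = 0, a.<2,1,0> = 0 & a.<2,0,1> = 0].
Proof.
move=> h1 h2 P E3 E2.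
have sq (u : K) : u * u = 0 -> u = 0.
  by move=> /eqP; rewrite mulf_eq0 orbb => /eqP.
have e42 := E3 4 2 isT isT; have e40 := E3 4 0 isT isT; have f04 := E2 0 4 isT isT.
rewrite /P /dcoef /conv2 /conv3 /rot3 /= !(h1, h2) // in e42 e40 f04.
by split; apply: sq; [apply: (lincomb e42)|apply: (lincomb f04)|apply: (lincomb e40)]; ring.
Qed.

(** After a111 = 0, let g = 2 w x + ... be the derivative of f in x, an affine form. The
    discriminant in x is g^2 - 4 w f = 1, so f is a polynomial in g, hence in x + t y + u z. The
    discriminants in y and z are then t^2 and u^2. *)
Lemma translation_nz a (P := nth 0 [:: 1; 0; 0; 0; 0]) :
  deqs a P -> deqs (rot3 a) P -> deqs (rot3 (rot3 a)) P ->
  [/\ a.<2,2,2> = 0, a.<2,2,1> = 0, a.<2,1,2> = 0 & a.<1,2,2> = 0] ->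
  [/\ a.<2,2,0> = 0, a.<2,0,2> = 0 & a.<0,2,2> = 0] ->
  [/\ a.<2,1,1> = 0, a.<1,2,1> = 0 & a.<1,1,2> = 0] ->
  [/\ a.<2,1,0> = 0, a.<2,0,1> = 0 & a.<1,2,0> = 0] ->
  [/\ a.<0,2,1> = 0, a.<1,0,2> = 0 & a.<0,1,2> = 0] -> a.<2,0,0> != 0 ->
  exists l m n e2 e3, [/\ m ^+ 2 - 4 * l * n = 1, e2 ^+ 2 = 1, e3 ^+ 2 = 1 &
    forall x y z : K, tform a (x, 1) (y, 1) (z, 1) = FEv l m n (x + e2 * y + e3 * z)].
Proof.
move=> E3 E1 E2 [a222 a221 a212 a122] [a220 a202 a022] [a211 a121 a112].
move=> [a210 a201 a120] [a021 a102 a012]; set w := a.<2,0,0> => w0.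
have vals := (a222, a221, a212, a122, a220, a202, a022, a211, a121, a112,
  a210, a201, a120, a021, a102, a012).
have sq (u : K) : u * u = 0 -> u = 0.
  by move=> /eqP; rewrite mulf_eq0 orbb => /eqP.
have e22 := E3 2 2 isT isT.
have g20 := E1 2 0 isT isT; have g02 := E1 0 2 isT isT; have g11 := E1 1 1 isT isT.
have g10 := E1 1 0 isT isT; have g01 := E1 0 1 isT isT; have g00 := E1 0 0 isT isT.
have h00 := E2 0 0 isT isT; have e00 := E3 0 0 isT isT.
rewrite /P /dcoef /conv2 /conv3 /rot3 /= !vals -/w in e22 g20 g02 g11 g10 g01 g00 h00 e00.
have a111 : a.<1,1,1> = 0 by apply: sq; apply: (lincomb e22); ring.
pose t := a.<1,1,0> / (2 * w); pose u := a.<1,0,1> / (2 * w).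
have a110 : a.<1,1,0> = 2 * w * t by rewrite /t; field.
have a101 : a.<1,0,1> = 2 * w * u by rewrite /u; field.
clearbody t u; rewrite ?(a110, a101, a111) in g20 g02 g11 g10 g01.
have a020 : a.<0,2,0> = w * t ^+ 2.
  by apply: (lincomb (lcM (- (4 * w)^-1) g20)); field.
have a002 : a.<0,0,2> = w * u ^+ 2.
  by apply: (lincomb (lcM (- (4 * w)^-1) g02)); field.
have a011 : a.<0,1,1> = 2 * w * t * u.
  by apply: (lincomb (lcM (- (4 * w)^-1) g11)); field.
have a010 : a.<0,1,0> = t * a.<1,0,0>.
  by apply: (lincomb (lcM (- (4 * w)^-1) g10)); field.
have a001 : a.<0,0,1> = u * a.<1,0,0>.
  by apply: (lincomb (lcM (- (4 * w)^-1) g01)); field.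
rewrite a010 a020 in h00; rewrite a001 a002 in e00.
exists w, a.<1,0,0>, a.<0,0,0>, t, u; split.
- by apply: (lincomb g00); ring.
- by apply: (lincomb (lcD h00 (lcM (- t ^+ 2) g00))); ring.
- by apply: (lincomb (lcD e00 (lcM (- u ^+ 2) g00))); ring.
- move=> x y z; rewrite /tform !big_ord_recr !big_ord0 /= !vals.
  by rewrite -/w a111 a110 a101 a020 a002 a011 a010 a001 /FEv !expr1n; ring.
Qed.

(** [biquad_lead0] applies for each value t of the third variable, and a quadratic polynomial in t
    that vanishes at 0, 1 and -1 is zero. *)
Lemma table22 f : triq f -> sds f (fun x => x.2 ^+ 4) ->
  forall k, (k < 3)%N -> table f 2%N 2%N k = 0.
Proof.
move=> [hx hy hz] sf.
have h t : f (1, 0) (1, 0) (t, 1) = 0.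
  apply: (biquad_lead0 (g := fun x y => f x y (t, 1))) => //.
  - by move=> x; have [_ -> _] := sf (t, 1) x; rewrite expr1n mul1r.
  - by move=> y; have [-> _ _] := sf y (t, 1); rewrite expr1n mulr1.
have hq := hz (1, 0) (1, 0); have h1 := h 1; have hm := h (-1); have h0 := h 0.
rewrite hq in h1; rewrite hq in hm.
case=> [|[|[|]]] // _.
- by apply: (lincomb (lcM 2^-1 (lcD h1 (lcM (-1) hm)))); rewrite /table /qcoef /=; field.
- apply: (lincomb (lcD (lcM 2^-1 (lcD h1 hm)) (lcM (-1) h0))).
  by rewrite /table /qcoef /=; field.
Qed.

Lemma translation_form f : triq f -> sds f (fun x => x.2 ^+ 4) ->
  exists l m n e1 e2 e3,
    [/\ m ^+ 2 - 4 * l * n = 1, e1 ^+ 2 = 1, e2 ^+ 2 = 1, e3 ^+ 2 = 1 &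
    forall x y z : K, f (x, 1) (y, 1) (z, 1) = FEv l m n (e1 * x + e2 * y + e3 * z)].
Proof.
move=> tf sf; pose P n : K := nth 0 [:: 1; 0; 0; 0; 0] n.
pose Q x : K := x.2 ^+ 4.
have qP (t : K) : Q (t, 1) = \sum_(i < 5) P i * t ^+ i.
  by rewrite /Q !big_ord_recr big_ord0 /P /=; ring.
have tr := triq_rot tf; have sr := sds_rot sf.
have trr := triq_rot tr; have srr := sds_rot sr.
have [E3 E1 E2] := sds_deqs3 tf sf qP.
have fE := tableE tf; have L3 := table22 tf sf.
have L1 k (hk : (k < 3)%N) := table22 tr sr hk.
have L2 k (hk : (k < 3)%N) := table22 trr srr hk.
have {}L1 k : (k < 3)%N -> table f k 2%N 2%N = 0.
  by move=> hk; rewrite -[RHS](L1 k hk) table_rot.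
have {}L2 k : (k < 3)%N -> table f 2%N k 2%N = 0.
  by move=> hk; rewrite -[RHS](L2 k hk) table_rot /rot3 table_rot.
move: (table f) fE E3 E1 E2 L1 L2 L3 => a fE E3 E1 E2 L1 L2 L3.
have [a211 a210 a201] := tab_lead L3 L2 E3 E2.
have [] := tab_lead (a := rot3 a) L1 L3 E1 E3; rewrite /rot3 => a121 a021 a120.
have [] := tab_lead (a := rot3 (rot3 a)) L2 L1 E2 E1; rewrite /rot3 => a112 a102 a012.
have [[a222 a221] a220] := (L3 2 isT, L3 1 isT, L3 0 isT)%N.
have [a122 a022] := (L1 1 isT, L1 0 isT)%N.
have [a212 a202] := (L2 1 isT, L2 0 isT)%N.
have fE' x y z : f x y z = tform (rot3 a) y z x.
  by rewrite fE /tform !big_ord_recr !big_ord0 /rot3 /=; ring.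
have fE'' x y z : f x y z = tform (rot3 (rot3 a)) z x y.
  by rewrite fE /tform !big_ord_recr !big_ord0 /rot3 /=; ring.
have [a200|w0] := eqVneq a.<2,0,0> 0; last first.
  have [//|//|//|//|//|l [m [n [e2 [e3 [h h2 h3 e]]]]]] := translation_nz E3 E1 E2 _ _ _ _ _ w0.
  exists l, m, n, 1, e2, e3; split=> // [|x y z]; first by rewrite expr1n.
  by rewrite fE e mul1r.
have [a020|w0] := eqVneq a.<0,2,0> 0; last first.
  have [//|//|//|//|//|l [m [n [e2 [e3 [h h2 h3 e]]]]]] := translation_nz (a := rot3 a) E1 E2 E3 _ _ _ _ _ w0.
  exists l, m, n, e3, 1, e2; split=> // [|x y z]; first by rewrite expr1n.
  by rewrite fE' e; congr FEv; ring.
have [a002|w0] := eqVneq a.<0,0,2> 0; last first.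
  have [//|//|//|//|//|l [m [n [e2 [e3 [h h2 h3 e]]]]]] := translation_nz (a := rot3 (rot3 a)) E2 E3 E1 _ _ _ _ _ w0.
  exists l, m, n, e2, e3, 1; split=> // [|x y z]; first by rewrite expr1n.
  by rewrite fE'' e; congr FEv; ring.
(* No squares are left. Then there are no mixed terms either, and f is affine with coefficients
   whose squares are the discriminants, that is 1. *)
have vals := (a222, a221, a212, a122, a220, a202, a022, a211, a121, a112,
  a210, a201, a120, a021, a102, a012, a200, a020, a002).
have sq (u : K) : u * u = 0 -> u = 0.
  by move=> /eqP; rewrite mulf_eq0 orbb => /eqP.
have e22 := E3 2 2 isT isT; have e20 := E3 2 0 isT isT; have e02 := E3 0 2 isT isT.
have g20 := E1 2 0 isT isT.
have e00 := E3 0 0 isT isT; have g00 := E1 0 0 isT isT; have h00 := E2 0 0 isT isT.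
rewrite /P /dcoef /conv2 /conv3 /rot3 /= !vals in e22 e20 e02 g20 e00 g00 h00.
have a111 : a.<1,1,1> = 0 by apply: sq; apply: (lincomb e22); ring.
have a101 : a.<1,0,1> = 0 by apply: sq; apply: (lincomb e20); ring.
have a011 : a.<0,1,1> = 0 by apply: sq; apply: (lincomb e02); ring.
have a110 : a.<1,1,0> = 0 by apply: sq; apply: (lincomb g20); ring.
exists 0, 1, a.<0,0,0>, a.<1,0,0>, a.<0,1,0>, a.<0,0,1>; split.
- by rewrite expr1n !mulr0 mul0r subr0.
- by apply: (lincomb g00); ring.
- by apply: (lincomb h00); ring.
- by apply: (lincomb e00); ring.
- move=> x y z; rewrite fE /tform !big_ord_recr !big_ord0 /= !vals.
  by rewrite a111 a110 a101 a011 /FEv !expr1n; ring.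
Qed.

(** A common sign of e1, e2, e3 is absorbed into m, which reduces eight sign patterns to four. *)
Lemma translation f : triq f -> sds f (fun x => x.2 ^+ 4) ->
  exists l m n, m ^+ 2 - 4 * l * n = 1 /\
  [\/ eqva f (fun x y z : K => FEv l m n (x + y + z)),
      eqva f (fun x y z : K => FEv l m n (y + z - x)),
      eqva f (fun x y z : K => FEv l m n (x + z - y)) |
      eqva f (fun x y z : K => FEv l m n (x + y - z))].
Proof.
move=> tf sf.
have [l [m [n [e1 [e2 [e3 [h /eqP h1 /eqP h2 /eqP h3 fE]]]]]]] := translation_form tf sf.
have h' : (- m) ^+ 2 - 4 * l * n = 1 by rewrite sqrrN.
move: h1 h2 h3; rewrite !sqrf_eq1.
by case/orP=> /eqP ?; case/orP=> /eqP ?; case/orP=> /eqP ?; subst e1 e2 e3;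
  [exists l, m, n; split=> //; apply: Or41
  |exists l, m, n; split=> //; apply: Or44
  |exists l, m, n; split=> //; apply: Or43
  |exists l, (- m), n; split=> //; apply: Or42
  |exists l, m, n; split=> //; apply: Or42
  |exists l, (- m), n; split=> //; apply: Or43
  |exists l, (- m), n; split=> //; apply: Or44
  |exists l, (- m), n; split=> //; apply: Or41];
  apply: eqva_affine => x y z; rewrite fE /FEv; ring.
Qed.

End Algebra.

(** * From affine points to forms, and discriminants of the listed polynomials *)

Section AffineDiscriminants.
Variable K : numClosedFieldType.
Local Notation V := (K * K)%type.
Implicit Types (f : V -> V -> V -> K) (q : V -> K).

Definition quartic q : Prop :=
  exists c : nat -> K, forall x, q x = \sum_(i < 5) c i * (x.1 ^+ i * x.2 ^+ (4 - i)).

Lemma quartic_ext q q' : quartic q -> quartic q' ->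
  (forall t, q (t, 1) = q' (t, 1)) -> q =1 q'.
Proof.
move=> [c hc] [c' hc'] h x; rewrite hc hc'; apply: eq_bigr => k _.
congr (_ * _); apply/eqP; rewrite -subr_eq0; apply/eqP.
have /pow_sum_eq0/(_ k) : forall t, \sum_(i < 5) (c i - c' i) * t ^+ i = 0.
  move=> t; have := h t; rewrite hc hc' => /eqP; rewrite -subr_eq0 => /eqP h0.
  rewrite -[RHS]h0 -sumrB; apply: eq_bigr => i _ /=.
  by rewrite expr1n mulr1 mulrBl.
by rewrite (big_pred1 k) // => i; rewrite -val_eqE.
Qed.

Lemma quartic_linear4 (k : K) (u v : nat -> K) :
  quartic (fun x => k * ((u 0%N * x.1 + v 0%N * x.2) * ((u 1%N * x.1 + v 1%N * x.2) *
    ((u 2%N * x.1 + v 2%N * x.2) * (u 3%N * x.1 + v 3%N * x.2))))).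
Proof.
pose c i := k * nth 0 [:: v 0%N * v 1%N * v 2%N * v 3%N;
  u 0%N * v 1%N * v 2%N * v 3%N + v 0%N * u 1%N * v 2%N * v 3%N
  + v 0%N * v 1%N * u 2%N * v 3%N + v 0%N * v 1%N * v 2%N * u 3%N;
  u 0%N * u 1%N * v 2%N * v 3%N + u 0%N * v 1%N * u 2%N * v 3%N
  + u 0%N * v 1%N * v 2%N * u 3%N + v 0%N * u 1%N * u 2%N * v 3%N
  + v 0%N * u 1%N * v 2%N * u 3%N + v 0%N * v 1%N * u 2%N * u 3%N;
  v 0%N * u 1%N * u 2%N * u 3%N + u 0%N * v 1%N * u 2%N * u 3%N
  + u 0%N * u 1%N * v 2%N * u 3%N + u 0%N * u 1%N * u 2%N * v 3%N;
  u 0%N * u 1%N * u 2%N * u 3%N] i.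
by exists c => x; rewrite !big_ord_recr big_ord0 /c /=; ring.
Qed.

Lemma quartic_scale (c : K) q : quartic q -> quartic (fun x => c * q x).
Proof.
move=> [d hd]; exists (fun i => c * d i) => x; rewrite hd mulr_sumr.
by apply: eq_bigr => i _; rewrite mulrA.
Qed.

Lemma quartic_disc (g : V -> V -> K) : (forall z, qform (fun x => g x z)) ->
  quartic (fun x => qdisc (g x)).
Proof.
move=> h; pose c j k := qcoef j (fun x => qcoef k (g x)).
exists (fun i => conv3 *%R (c^~ 1%N) (c^~ 1%N) i - 4 * conv3 *%R (c^~ 2%N) (c^~ 0%N) i) => x.
have e k : (k < 3)%N -> qcoef k (g x) =
    c 2%N k * x.1 ^+ 2 + c 1%N k * (x.1 * x.2) + c 0%N k * x.2 ^+ 2.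
  case: k => [|[|[|]]] //= _.
  - exact: h.
  - by rewrite (h (1, 1) x) (h (1, 0) x) (h (0, 1) x) /c /qcoef; ring.
  - exact: h.
rewrite /qdisc !e //; clearbody c.
by rewrite !big_ord_recr big_ord0 /conv3 /=; ring.
Qed.

(** Both sides are binary quartics in each pair, and these are determined by their affine values;
    the points at infinity are added one pair at a time. *)
Lemma disc_affine f q : triq f -> quartic q ->
  (forall s t, qdisc (f (s, 1) (t, 1)) = q (s, 1) * q (t, 1)) ->
  forall x y, qdisc (f x y) = q x * q y.
Proof.
move=> [hx hy hz] qq h x y.
have h1 x' t : qdisc (f x' (t, 1)) = q x' * q (t, 1).
  rewrite mulrC; move: x'; apply: quartic_ext.
  - by apply: (quartic_disc (g := fun x' => f x' (t, 1))) => z; apply: hx.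
  - exact: quartic_scale.
  - by move=> s; rewrite mulrC.
move: y; apply: quartic_ext => //.
- by apply: (quartic_disc (g := fun y' => f x y')) => z; apply: hy.
- exact: quartic_scale.
Qed.

(** The discriminant with coefficients interpolated from the values at 1, -1 and 0, so that the
    listed polynomials are checked by [field] alone. *)
Definition adisc (g : K -> K) : K :=
  ((g 1 - g (-1)) / 2) ^+ 2 - 4 * ((g 1 + g (-1)) / 2 - g 0) * g 0.

Lemma adiscE (c2 c1 c0 : K) g : (forall t, g t = c2 * t ^+ 2 + c1 * t + c0) ->
  adisc g = c1 ^+ 2 - 4 * c2 * c0.
Proof. by move=> h; rewrite /adisc !h; field. Qed.

Lemma eq_adisc g g' : g =1 g' -> adisc g = adisc g'.
Proof. by move=> h; rewrite /adisc !h. Qed.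

Lemma adisc_qform q : qform q -> adisc (fun t => q (t, 1)) = qdisc q.
Proof. by move=> h; apply: adiscE => t; rewrite h /= expr1n !mulr1. Qed.

Definition sds_affine f (p : K -> K) : Prop := forall s t,
  [/\ adisc (fun w => f (w, 1) (s, 1) (t, 1)) = p s * p t,
      adisc (fun w => f (t, 1) (w, 1) (s, 1)) = p s * p t
    & adisc (fun w => f (s, 1) (t, 1) (w, 1)) = p s * p t].

Lemma sds_affineW f q : triq f -> quartic q ->
  sds_affine f (fun t => q (t, 1)) -> sds f q.
Proof.
move=> tf qq h x y; have tr := triq_rot tf; have trr := triq_rot tr.
have [[hx hy hz] [rx ry rz] [sx sy sz]] := And3 tf tr trr.
split.
- apply: (disc_affine tr) => // s t; have [h1 _ _] := h s t.
  by rewrite -h1 -(adisc_qform (rz _ _)).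
- apply: (disc_affine trr) => // s t; have [_ h1 _] := h s t.
  by rewrite -h1 -(adisc_qform (sz _ _)).
- apply: (disc_affine tf) => // s t; have [_ _ h1] := h s t.
  by rewrite -h1 -(adisc_qform (hz _ _)).
Qed.

Definition sdsv (h : K -> K -> K -> K) (p : K -> K) : Prop := forall s t,
  [/\ adisc (fun w => h w s t) = p s * p t, adisc (fun w => h t w s) = p s * p t
    & adisc (fun w => h s t w) = p s * p t].

Lemma eq_sdsv h p p' : sdsv h p -> p =1 p' -> sdsv h p'.
Proof. by move=> hp e s t; rewrite -!e. Qed.

Lemma sdsv_FA (k : K) : sdsv (FAv k) (fun t => (k ^+ 2 * t ^+ 2 - 1) * (t ^+ 2 - 1)).
Proof. by move=> s t; split; rewrite /adisc /FAv; field. Qed.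

Lemma sdsv_FB (e : K) : sdsv (FBv e) (fun t => t ^+ 2 - e ^+ 2).
Proof. by move=> s t; split; rewrite /adisc /FBv; field. Qed.

Lemma sdsv_FD : sdsv (@FDv K) id.
Proof. by move=> s t; split; rewrite /adisc /FDv; field. Qed.

Section FamilyConstants.
Variables l m n : K.
Hypothesis lmn : m ^+ 2 - 4 * l * n = 1.

(** Inserting the factor m^2 - 4 l n on the right turns each claim into an identity in free
    parameters. *)
Let lmnE (x : K) : x = (m ^+ 2 - 4 * l * n) * x.
Proof. by rewrite lmn mul1r. Qed.

Lemma sdsv_FC1 : sdsv (FCv1 l m n) (fun t => t ^+ 2).
Proof. by move=> s t; split; rewrite [RHS]lmnE /adisc /FCv1; field. Qed.

Lemma sdsv_FC2 : sdsv (FCv2 l m n) (fun t => t ^+ 2).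
Proof. by move=> s t; split; rewrite [RHS]lmnE /adisc /FCv2; field. Qed.

Lemma sdsv_FC3 : sdsv (FCv3 l m n) (fun t => t ^+ 2).
Proof. by move=> s t; split; rewrite [RHS]lmnE /adisc /FCv3; field. Qed.

Lemma sdsv_FC4 : sdsv (FCv4 l m n) (fun t => t ^+ 2).
Proof. by move=> s t; split; rewrite [RHS]lmnE /adisc /FCv4; field. Qed.

Lemma sdsv_FE1 : sdsv (fun x y z => FEv l m n (x + y + z)) (fun _ => 1).
Proof. by move=> s t; split; rewrite [RHS]lmnE /adisc /FEv; field. Qed.

Lemma sdsv_FE2 : sdsv (fun x y z => FEv l m n (y + z - x)) (fun _ => 1).
Proof. by move=> s t; split; rewrite [RHS]lmnE /adisc /FEv; field. Qed.

Lemma sdsv_FE3 : sdsv (fun x y z => FEv l m n (x + z - y)) (fun _ => 1).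
Proof. by move=> s t; split; rewrite [RHS]lmnE /adisc /FEv; field. Qed.

Lemma sdsv_FE4 : sdsv (fun x y z => FEv l m n (x + y - z)) (fun _ => 1).
Proof. by move=> s t; split; rewrite [RHS]lmnE /adisc /FEv; field. Qed.

End FamilyConstants.

End AffineDiscriminants.

(** * Polynomials in three variables through their values, and the gauge action on them *)

Section Evaluation.
Variable R : realType.
Local Notation K := R[i].
Local Notation V := (K * K)%type.
Implicit Types (F G : {mpoly K[3]}) (P : {poly K}) (u : 'I_3 -> K).

Definition pt3 (T : Type) (x y z : T) (i : 'I_3) : T :=
  match val i with 0 => x | 1 => y | _ => z end.

Lemma ord3P (i : 'I_3) : [\/ i = i1, i = i2 | i = i3].
Proof.
by case: i => [[|[|[|//]]] hi]; [apply: Or31|apply: Or32|apply: Or33]; apply: val_inj.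
Qed.

Lemma big_ord3 (T : Type) (idx : T) (op : Monoid.law idx) (g : 'I_3 -> T) :
  \big[op/idx]_(i < 3) g i = op (op (g i1) (g i2)) (g i3).
Proof.
rewrite !big_ord_recr big_ord0 /= Monoid.mul1m.
by congr (op (op (g _) (g _)) (g _)); apply: val_inj.
Qed.

(** The exponents of the three variables are fixed in turn, until [m0] is the only monomial left in
    the sum. *)
Lemma meval_eq0 F : (forall u, F.@[u] = 0) -> F = 0.
Proof.
move=> h; apply/mpolyP => m0; rewrite mcoeff0.
have h1 y z : \sum_(m <- msupp F | true && (m i1 == m0 i1))
    (F@_m * (y ^+ m i2 * z ^+ m i3)) = 0.
  apply: pow_sum_eq0 => x; rewrite -[RHS](h (pt3 x y z)) mevalE.
  by apply: eq_bigr => m _; rewrite big_ord3 /=; ring.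
have h2 z : \sum_(m <- msupp F | (true && (m i1 == m0 i1)) && (m i2 == m0 i2))
    (F@_m * z ^+ m i3) = 0.
  apply: pow_sum_eq0 => y; rewrite -[RHS](h1 y z).
  by apply: eq_bigr => m _; ring.
have := pow_sum_eq0 h2 (m0 i3).
have [m0F|m0F _] := boolP (m0 \in msupp F); last exact: memN_msupp_eq0.
rewrite big_mkcond (bigD1_seq m0) ?msupp_uniq //= !eqxx /= big1 ?addr0 // => m mm0.
case: ifP => // /andP[/andP[/eqP e1 /eqP e2] /eqP e3].
case/eqP: mm0; apply/mnmP => i.
by case: (ord3P i) => ->.
Qed.

Lemma meval_inj F G : (forall u, F.@[u] = G.@[u]) -> F = G.
Proof.
by move=> h; apply/eqP; rewrite -subr_eq0; apply/eqP/meval_eq0 => u;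
  rewrite mevalB h subrr.
Qed.

Lemma mevalXn F u n : (F ^+ n).@[u] = F.@[u] ^+ n.
Proof. exact: rmorphXn. Qed.

Lemma meval_term F G u k l : (F ^+ k * G ^+ l).@[u] = F.@[u] ^+ k * G.@[u] ^+ l.
Proof. by rewrite (mevalM u (F ^+ k) (G ^+ l)) !mevalXn. Qed.

Lemma meval_in_var P i u : (in_var P i).@[u] = P.[u i].
Proof.
rewrite /in_var -horner_map /= mevalXU -map_poly_comp map_poly_id // => c _ /=.
exact: mevalC.
Qed.

Definition upd u i t j : K := if j == i then t else u j.

Lemma meval_upd F i u t : deg_le2 F -> F.@[upd u i t] =
  (coef_at i 2 F).@[u] * t ^+ 2 + (coef_at i 1 F).@[u] * t + (coef_at i 0 F).@[u].
Proof.
move=> dF.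
have e n : (coef_at i n F).@[u] = 
    \sum_(m <- msupp F | m i == n) F@_m * \prod_(j < 3 | j != i) u j ^+ m j.
  rewrite /coef_at raddf_sum; apply: eq_bigr => m /eqP mi /=.
  rewrite mevalZ mevalX (bigD1 i) //= mnmBE mulmnE mnmE eqxx mul1n mi subnn mul1r.
  congr (_ * _); apply: eq_bigr => j ji.
  by rewrite mnmBE mulmnE mnmE eq_sym (negPf ji) mul0n subn0.
rewrite !e mevalE !mulr_suml !(big_mkcond (fun m => _ == _)) -!big_split /=.
rewrite !big_seq; apply: eq_bigr => m mF.
rewrite (bigD1 i) //= {1}/upd eqxx.
rewrite (eq_bigr (fun j => u j ^+ m j)); last by move=> j ji; rewrite /upd (negPf ji).
by case: (m i) (dF m mF i) => [|[|[|]]] //= _; ring.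
Qed.

Lemma discr_adisc F i u : deg_le2 F ->
  (discr i F).@[u] = adisc (fun t => F.@[upd u i t]).
Proof.
move=> dF; rewrite (adiscE (fun t => meval_upd i u t dF)) /discr mevalB !mevalM.
by rewrite -expr2 rmorph_nat.
Qed.

(** The truncated [2 - k] is a true difference under [deg_le2]. *)
Definition hmon (k : nat) (x : V) : K := x.1 ^+ k * x.2 ^+ (2 - k).

Definition hform F (x y z : V) : K :=
  \sum_(m <- msupp F) F@_m * (hmon (m i1) x * hmon (m i2) y * hmon (m i3) z).

Lemma form_affine F (x y z : K) : hform F (x, 1) (y, 1) (z, 1) = F.@[pt3 x y z].
Proof.
rewrite /hform mevalE; apply: eq_bigr => m _.
by rewrite big_ord3 /hmon /= !expr1n !mulr1.
Qed.

Lemma qform_hmon (c : K) k : (k <= 2)%N -> qform (fun x : V => c * hmon k x).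
Proof. by case: k => [|[|[|]]] // _ x; rewrite /hmon /qcoef /=; ring. Qed.

Lemma qform_sum (I : eqType) (s : seq I) (g : I -> V -> K) :
  (forall i, i \in s -> qform (g i)) -> qform (fun x => \sum_(i <- s) g i x).
Proof.
elim: s => [|i s ih] h z; first by rewrite /qcoef !big_nil; ring.
have hi := h i (mem_head _ _) z.
have {}ih := ih (fun j js => h j (mem_behead (s := i :: s) js)) z.
by rewrite /qcoef !big_cons hi ih /qcoef; ring.
Qed.

Lemma triq_form F : deg_le2 F -> triq (hform F).
Proof.
move=> dF; split=> u v; apply: qform_sum => m mF.
- apply: eq_qform (qform_hmon (F@_m * (hmon (m i2) u * hmon (m i3) v)) (dF m mF i1)).
  by move=> x; ring.
- apply: eq_qform (qform_hmon (F@_m * (hmon (m i1) u * hmon (m i3) v)) (dF m mF i2)).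
  by move=> x; ring.
- apply: eq_qform (qform_hmon (F@_m * (hmon (m i1) u * hmon (m i2) v)) (dF m mF i3)).
  by move=> x; ring.
Qed.

Lemma form_sds_affine F P : strongly_discr_sep F P -> sds_affine (hform F) (horner P).
Proof.
move=> [dF _ _ [d1 d2 d3]] s t.
split.
(* The entry 0 is a placeholder that [upd] overwrites. *)
- have := congr1 (meval (pt3 0 s t)) d1.
  rewrite mevalM !meval_in_var discr_adisc // => <-; apply: eq_adisc => w.
  by rewrite form_affine; apply: meval_eq => i; case: (ord3P i) => ->.
- have := congr1 (meval (pt3 t 0 s)) d2.
  rewrite mevalM !meval_in_var discr_adisc // => <-; apply: eq_adisc => w.
  by rewrite form_affine; apply: meval_eq => i; case: (ord3P i) => ->.
- have := congr1 (meval (pt3 s t 0)) d3.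
  rewrite mevalM !meval_in_var discr_adisc // => <-; apply: eq_adisc => w.
  by rewrite form_affine; apply: meval_eq => i; case: (ord3P i) => ->.
Qed.

Lemma strongly_discr_sepI F P (h : K -> K -> K -> K) :
  (forall u, F.@[u] = h (u i1) (u i2) (u i3)) ->
  deg_le2 F -> P != 0 -> (size P <= 5)%N ->
  sdsv h (horner P) ->
  strongly_discr_sep F P.
Proof.
move=> hF dF P0 sP hd; split=> //; split; apply: meval_inj => u;
  rewrite discr_adisc // mevalM !meval_in_var.
- by have [<- _ _] := hd (u i2) (u i3); apply: eq_adisc => w; rewrite hF.
- by have [_ <- _] := hd (u i3) (u i1); apply: eq_adisc => w; rewrite hF.
- by have [_ _ <-] := hd (u i1) (u i2); apply: eq_adisc => w; rewrite hF.
Qed.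

Lemma num_at_neq0 (c d : K) i : (c != 0) || (d != 0) -> num_at c d i != 0.
Proof.
move=> cd; apply/eqP => e.
have h t : c * t + d = 0.
  have := congr1 (meval (fun=> t)) e.
  by rewrite /num_at mevalD mevalZ mevalXU mevalC meval0.
have d0 : d = 0 by have := h 0; rewrite mulr0 add0r.
have c0 : c = 0 by have := h 1; rewrite d0 addr0 mulr1.
by rewrite c0 d0 eqxx in cd.
Qed.

(** The polynomial that [gauge] yields: the factors (c x + d)^2 cancel the denominators of each
    monomial, whose exponents are at most 2. *)
Definition subst_num (a b c d : K) F : {mpoly K[3]} := \sum_(m <- msupp F)
  F@_m *: \prod_(i < 3) (num_at a b i ^+ m i * num_at c d i ^+ (2 - m i)).

Lemma tofrac_dehom (A : idomainType) (N D : A) k : D != 0 -> (k <= 2)%N ->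
  tofrac D ^+ 2 * (tofrac N / tofrac D) ^+ k = tofrac (N ^+ k * D ^+ (2 - k)).
Proof.
move=> D0 hk; have F0 : tofrac D != 0 by rewrite tofrac_eq0.
rewrite rmorphM !rmorphXn /= expr_div_n mulrCA; congr (_ * _).
by rewrite -{1}(subnK hk) exprD mulfK // expf_neq0.
Qed.

Lemma gaugeE (a b c d : K) F : a * d - b * c != 0 -> deg_le2 F ->
  gauge a b c d F = tofrac (subst_num a b c d F).
Proof.
move=> det dF; rewrite /gauge /mmap /subst_num raddf_sum /= mulr_sumr.
rewrite big_seq [RHS]big_seq; apply: eq_bigr => m mF.
rewrite -mul_mpolyC rmorphM /= mulrCA; congr (_ * _).
rewrite /mmap1 -big_split /= rmorph_prod; apply: eq_bigr => i _ /=.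
have D0 : num_at c d i != 0.
  apply: num_at_neq0; apply: contraNT det.
  by rewrite negb_or !negbK => /andP[/eqP -> /eqP ->]; rewrite !mulr0 subr0.
exact: (tofrac_dehom (num_at a b i) D0 (dF m mF i)).
Qed.

Lemma meval_subst_num (a b c d x y z : K) F :
  (subst_num a b c d F).@[pt3 x y z] = mobius_act ((a, b), (c, d)) (hform F) (x, 1) (y, 1) (z, 1).
Proof.
rewrite /subst_num raddf_sum /mobius_act /hform; apply: eq_bigr => m _ /=.
rewrite mevalZ; congr (_ * _).
transitivity (\prod_(i < 3) ((num_at a b i).@[pt3 x y z] ^+ m i *
    (num_at c d i).@[pt3 x y z] ^+ (2 - m i))).
  by rewrite rmorph_prod; apply: eq_bigr => i _; exact: meval_term.
rewrite big_ord3 /=.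
by rewrite /num_at !mevalD !mevalZ !mevalXU !mevalC /hmon /mact /= !mulr1.
Qed.

Lemma eqva_equivalent F G h : deg_le2 F ->
  (forall u, G.@[u] = h (u i1) (u i2) (u i3)) ->
  eqva (hform F) h -> equivalent F G.
Proof.
move=> dF hG [[[a b] [c d]] det hh]; exists a, b, c, d; split=> //.
rewrite gaugeE //; congr tofrac; apply: meval_inj => u.
rewrite hG hh -meval_subst_num; apply: meval_eq => i.
by case: (ord3P i) => ->.
Qed.

End Evaluation.

(** * Zeros on the projective line *)

Section Zeros.
Variable R : realType.
Local Notation K := R[i].
Implicit Types (P : {poly K}) (z : option K) (zs : seq (option K)).

(* Up to sign, the linear form vanishing at [z], dehomogenized. *)
Definition fac z : {poly K} := if z is Some r then 'X - r%:P else -1.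

Lemma prod_fac zs : exists2 c : K, c != 0 &
  \prod_(z <- zs) fac z = c *: \prod_(r <- pmap id zs) ('X - r%:P).
Proof.
elim: zs => [|[r|] zs [c c0 ih]]; rewrite ?big_nil ?big_cons.
- by exists 1; rewrite ?oner_eq0 // scale1r.
- by exists c; rewrite // ih scalerAr.
- by exists (- c); rewrite ?oppr_eq0 //= ih mulN1r scaleNr.
Qed.

Lemma count_mem_pmap zs (r : K) : count_mem r (pmap id zs) = count_mem (Some r) zs.
Proof. by elim: zs => [|[s|] zs ih] //=; rewrite ih. Qed.

Lemma size_pmap_id zs : size (pmap id zs) = (size zs - count_mem None zs)%N.
Proof.
have <- : (size (pmap id zs) + count_mem None zs = size zs)%N; last by rewrite addnK.
by elim: zs => [|[s|] zs ih] //=; rewrite ?add0n ?addSn ?add1n ?addnS ih.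
Qed.

Section Factored.
Variables (P : {poly K}) (k : K) (zs : seq (option K)).
Hypotheses (k0 : k != 0) (PE : P = k *: \prod_(z <- zs) fac z) (s4 : size zs = 4%N).

Lemma factored_monic : exists2 c : K, c != 0 &
  P = c *: \prod_(r <- pmap id zs) ('X - r%:P).
Proof.
have [c c0 e] := prod_fac zs.
by exists (k * c); rewrite ?mulf_neq0 // PE e scalerA.
Qed.

Lemma factored_count : (count_mem None zs <= 4)%N.
Proof. by rewrite (leq_trans (count_size _ _)) ?s4. Qed.

Lemma factored_size : size P = (5 - count_mem None zs)%N.
Proof.
have [c c0 ->] := factored_monic.
by rewrite size_scale // size_prod_XsubC size_pmap_id s4 (subSn factored_count).
Qed.

Lemma factored_neq0 : P != 0.
Proof.
have [c c0 ->] := factored_monic.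
by rewrite scaler_eq0 (negPf c0) /= monic_neq0 // monic_prod_XsubC.
Qed.

Lemma factored_mult z : zero_mult P z = count_mem z zs.
Proof.
case: z => [x|] /=; last first.
  by rewrite factored_size (subSn factored_count) (subKn factored_count).
have [c c0 ->] := factored_monic.
rewrite -mul_polyC mupMr ?rootC // ?mu_prod_XsubC ?count_mem_pmap //.
Qed.

Lemma factored_zero_type (ws : seq (option K)) (s : seq nat) : uniq ws ->
  [seq count_mem z zs | z <- ws] = s -> {subset zs <= ws} -> zero_type P s.
Proof.
move=> uw es sub; exists ws; split=> //.
- by rewrite -es; apply: eq_map => z; rewrite factored_mult.
- by move=> z; rewrite factored_mult -has_count has_pred1 => /sub.
Qed.
End Factored.

Lemma factor_exists P : P != 0 -> (size P <= 5)%N -> exists k zs,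
  [/\ k != 0, size zs = 4%N & P = k *: \prod_(z <- zs) fac z].
Proof.
move=> P0 sP; have [rs Prs] := closed_field_poly_normal P.
have l0 : lead_coef P != 0 by rewrite lead_coef_eq0.
have srs : (size rs <= 4)%N.
  by have := sP; rewrite Prs size_scale // size_prod_XsubC.
(* The missing zeros lie at infinity; each brings the factor -1 of [fac None], for which (-1)^n
   compensates. *)
pose n := (4 - size rs)%N.
exists (lead_coef P * (-1) ^+ n), (map Some rs ++ nseq n None); split.
- by rewrite mulf_neq0 // expf_neq0 // oppr_eq0 oner_eq0.
- by rewrite size_cat size_map size_nseq subnKC.
- rewrite big_cat big_map big_nseq /= iter_mulr_1.
  have -> : (-1) ^+ n = ((-1) ^+ n)%:P :> {poly K} by rewrite rmorphXn /= rmorphN1.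
  rewrite [X in _ *: X]mulrC mul_polyC scalerA -mulrA -exprD addnn -signr_odd odd_double mulr1.
  exact: Prs.
Qed.

(** The five partitions of 4. Repeated points come last, so that the first point, later sent to
    infinity, is a simple zero whenever there is one. *)
Lemma seq4_cases (T : eqType) (s : seq T) : size s = 4%N -> exists a b c d,
  perm_eq s [:: a; b; c; d] /\
  [\/ uniq [:: a; b; c; d], uniq [:: a; b; c] /\ d = c, [/\ a = b, d = c & a != c]
    | a != b /\ (c = b /\ d = b) \/ [/\ b = a, c = a & d = a]].
Proof.
case: s => [|x1 [|x2 [|x3 [|x4 [|//]]]]] // _.
have pm (a b c d : T) : (forall p : pred T,
    (p x1 + (p x2 + (p x3 + p x4)) = p a + (p b + (p c + p d)))%N) ->
    perm_eq [:: x1; x2; x3; x4] [:: a; b; c; d].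
  by move=> h; apply/permP => p; rewrite /= !addn0.
have [e12|n12] := eqVneq x1 x2.
  have [e34|n34] := eqVneq x3 x4.
    have [e13|n13] := eqVneq x1 x3.
      by exists x1, x1, x1, x1; split; [apply: pm => p; subst|apply: Or44; right].
    by exists x1, x2, x3, x4; split; [apply: pm|apply: Or43; split].
  have [e13|n13] := eqVneq x1 x3.
    exists x4, x1, x1, x1; split; [apply: pm => p; subst x2 x3; ring|].
    by apply: Or44; left; rewrite eq_sym e13.
  have [e14|n14] := eqVneq x1 x4.
    exists x3, x1, x1, x1; split; [apply: pm => p; subst x2 x4; ring|].
    by apply: Or44; left; rewrite eq_sym.
  exists x3, x4, x1, x1; split; [apply: pm => p; subst x2; ring|].
  by apply: Or42; rewrite /= !inE !negb_or n34 eq_sym n13 eq_sym n14.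
have [e34|n34] := eqVneq x3 x4.
  have [e13|n13] := eqVneq x1 x3.
    exists x2, x1, x1, x1; split; [apply: pm => p; subst x3 x4; ring|].
    by apply: Or44; left; rewrite eq_sym n12.
  have [e23|n23] := eqVneq x2 x3.
    exists x1, x2, x2, x2; split; [apply: pm => p; subst x4 x3; ring|].
    by apply: Or44; left.
  exists x1, x2, x3, x3; split; [apply: pm => p; subst x4; ring|].
  by apply: Or42; rewrite /= !inE !negb_or n12 n13 n23.
have [e13|n13] := eqVneq x1 x3.
  have [e24|n24] := eqVneq x2 x4.
    exists x1, x1, x2, x2; split; [apply: pm => p; subst x3 x4; ring|].
    by apply: Or43.
  exists x2, x4, x1, x1; split; [apply: pm => p; subst x3; ring|].
  by apply: Or42; rewrite /= !inE !negb_or n24 eq_sym n12 e13 eq_sym n34.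
have [e14|n14] := eqVneq x1 x4.
  have [e23|n23] := eqVneq x2 x3.
    exists x1, x1, x2, x2; split; [apply: pm => p; subst x3 x4; ring|].
    by apply: Or43.
  exists x2, x3, x1, x1; split; [apply: pm => p; subst x4; ring|].
  by apply: Or42; rewrite /= !inE !negb_or n23 eq_sym n12 eq_sym n13.
have [e23|n23] := eqVneq x2 x3.
  exists x1, x4, x2, x2; split; [apply: pm => p; subst x3; ring|].
  by apply: Or42; rewrite /= !inE !negb_or n14 n12 e23 eq_sym n34.
have [e24|n24] := eqVneq x2 x4.
  exists x1, x3, x2, x2; split; [apply: pm => p; subst x4; ring|].
  by apply: Or42; rewrite /= !inE !negb_or n13 n12 eq_sym n23.
exists x1, x2, x3, x4; split; first exact: pm.
by apply: Or41; rewrite /= !inE !negb_or n12 n13 n14 n23 n24 n34.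
Qed.

End Zeros.

(** * Degrees and values of explicit polynomials *)

Section Degree.
Variable R : realType.
Local Notation K := R[i].
Implicit Types (F G : {mpoly K[3]}) (P : {poly K}) (u : 'I_3 -> K) (i : 'I_3).

Definition deg_in i n F := forall m, m \in msupp F -> (m i <= n)%N.

Lemma deg_inD i n n' F G : deg_in i n F -> deg_in i n' G -> deg_in i (maxn n n') (F + G).
Proof.
move=> hF hG m /msuppD_le; rewrite mem_cat leq_max.
by case/orP=> [/hF|/hG] ->; rewrite ?orbT.
Qed.

Lemma deg_inN i n F : deg_in i n F -> deg_in i n (- F).
Proof. by move=> hF m; rewrite (perm_mem (msuppN F)) => /hF. Qed.

Lemma deg_inZ i n (c : K) F : deg_in i n F -> deg_in i n (c *: F).
Proof. by move=> hF m /msuppZ_le /hF. Qed.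

Lemma deg_inM i n n' F G : deg_in i n F -> deg_in i n' G -> deg_in i (n + n') (F * G).
Proof.
move=> hF hG m /msuppM_le /allpairsP[[m1 m2] /= [h1 h2 ->]].
by rewrite mnmDE leq_add ?hF ?hG.
Qed.

Lemma deg_inC i (c : K) : deg_in i 0 c%:MP.
Proof. by move=> m; rewrite msuppC; case: ifP; rewrite // inE => _ /eqP ->; rewrite mnm0E. Qed.

Lemma deg_in1 i : deg_in i 0 1.
Proof. exact: deg_inC. Qed.

Lemma deg_inX i j : deg_in i (j == i) ('X_j : {mpoly K[3]}).
Proof. by move=> m; rewrite msuppX inE => /eqP ->; rewrite mnmE. Qed.

Lemma deg_inXn i n F k : deg_in i n F -> deg_in i (k * n) (F ^+ k).
Proof.
move=> hF; elim: k => [|k ih]; first by rewrite expr0; apply: deg_in1.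
by rewrite exprS mulSn; apply: deg_inM.
Qed.

Lemma deg_in_le2 F n1 n2 n3 : (n1 <= 2)%N -> (n2 <= 2)%N -> (n3 <= 2)%N ->
  deg_in i1 n1 F -> deg_in i2 n2 F -> deg_in i3 n3 F -> deg_le2 F.
Proof.
move=> h1 h2 h3 d1 d2 d3 m hm i; case: (ord3P i) => ->.
- exact: leq_trans (d1 m hm) h1.
- exact: leq_trans (d2 m hm) h2.
- exact: leq_trans (d3 m hm) h3.
Qed.

Lemma ev_add u F G (x y : K) : F.@[u] = x -> G.@[u] = y -> (F + G).@[u] = x + y.
Proof. by rewrite mevalD => -> ->. Qed.
Lemma ev_mul u F G (x y : K) : F.@[u] = x -> G.@[u] = y -> (F * G).@[u] = x * y.
Proof. by rewrite mevalM => -> ->. Qed.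
Lemma ev_opp u F (x : K) : F.@[u] = x -> (- F).@[u] = - x.
Proof. by rewrite mevalN => ->. Qed.
Lemma ev_scale u (c : K) F (x : K) : F.@[u] = x -> (c *: F).@[u] = c * x.
Proof. by rewrite mevalZ => ->. Qed.
Lemma ev_exp u F (x : K) n : F.@[u] = x -> (F ^+ n).@[u] = x ^+ n.
Proof. by rewrite mevalXn => ->. Qed.
End Degree.

Local Ltac deg_step :=
  lazymatch goal with
  | |- deg_in _ _ (_ + _) => eapply deg_inD
  | |- deg_in _ _ (- _) => eapply deg_inN
  | |- deg_in _ _ (_ *: _) => eapply deg_inZ
  | |- deg_in _ _ (_ ^+ _) => eapply deg_inXn
  | |- deg_in _ _ (_ * _) => eapply deg_inM
  | |- deg_in _ _ (_%:MP) => eapply deg_inC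
  | |- deg_in _ _ 1 => eapply deg_in1
  | |- deg_in _ _ ('X_ _) => eapply deg_inX
  end.

(** The three bounds are unification variables filled in from the shape of the polynomial; the
    inequalities are then decided by computation. *)
Local Ltac deg_le2_tac :=
  by eapply deg_in_le2; [| | |repeat deg_step|repeat deg_step|repeat deg_step].

Local Ltac ev_step :=
  lazymatch goal with
  | |- meval _ (_ + _) = _ => eapply ev_add
  | |- meval _ (- _) = _ => eapply ev_opp
  | |- meval _ (_ *: _) = _ => eapply ev_scale
  | |- meval _ (_ ^+ _) = _ => eapply ev_exp
  | |- meval _ (_ * _) = _ => eapply ev_mul
  | |- meval _ (_%:MP) = _ => eapply mevalC
  | |- meval _ 1 = _ => eapply meval1
  | |- meval _ ('X_ _) = _ => eapply mevalXU
  end.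

Local Ltac ev_tac := eapply etrans; [by repeat ev_step|].

(** * The listed polynomials satisfy the condition *)

Section Canonical.
Variable R : realType.
Local Notation K := R[i].
Implicit Types (k e l m n : K) (u : 'I_3 -> K).

Lemma deg_FA k : deg_le2 (FA k). Proof. rewrite /FA; deg_le2_tac. Qed.
Lemma deg_FB e : deg_le2 (FB e). Proof. rewrite /FB; deg_le2_tac. Qed.
Lemma deg_FC1 l m n : deg_le2 (FC1 l m n). Proof. rewrite /FC1; deg_le2_tac. Qed.
Lemma deg_FC2 l m n : deg_le2 (FC2 l m n). Proof. rewrite /FC2; deg_le2_tac. Qed.
Lemma deg_FC3 l m n : deg_le2 (FC3 l m n). Proof. rewrite /FC3; deg_le2_tac. Qed.
Lemma deg_FC4 l m n : deg_le2 (FC4 l m n). Proof. rewrite /FC4; deg_le2_tac. Qed.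
Lemma deg_FD : deg_le2 (@FD R). Proof. rewrite /FD; deg_le2_tac. Qed.
Lemma deg_FE1 l m n : deg_le2 (FE1 l m n). Proof. rewrite /FE1; deg_le2_tac. Qed.
Lemma deg_FE2 l m n : deg_le2 (FE2 l m n). Proof. rewrite /FE2; deg_le2_tac. Qed.
Lemma deg_FE3 l m n : deg_le2 (FE3 l m n). Proof. rewrite /FE3; deg_le2_tac. Qed.
Lemma deg_FE4 l m n : deg_le2 (FE4 l m n). Proof. rewrite /FE4; deg_le2_tac. Qed.

Lemma meval_FA k u : (FA k).@[u] = FAv k (u i1) (u i2) (u i3).
Proof. by rewrite /FA; ev_tac. Qed.
Lemma meval_FB e u : (FB e).@[u] = FBv e (u i1) (u i2) (u i3).
Proof. by rewrite /FB; ev_tac. Qed.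
Lemma meval_FC1 l m n u : (FC1 l m n).@[u] = FCv1 l m n (u i1) (u i2) (u i3).
Proof. by rewrite /FC1; ev_tac. Qed.
Lemma meval_FC2 l m n u : (FC2 l m n).@[u] = FCv2 l m n (u i1) (u i2) (u i3).
Proof. by rewrite /FC2; ev_tac. Qed.
Lemma meval_FC3 l m n u : (FC3 l m n).@[u] = FCv3 l m n (u i1) (u i2) (u i3).
Proof. by rewrite /FC3; ev_tac. Qed.
Lemma meval_FC4 l m n u : (FC4 l m n).@[u] = FCv4 l m n (u i1) (u i2) (u i3).
Proof. by rewrite /FC4; ev_tac. Qed.
Lemma meval_FD u : (@FD R).@[u] = FDv (u i1) (u i2) (u i3).
Proof. by rewrite /FD; ev_tac. Qed.
Lemma meval_FE1 l m n u : (FE1 l m n).@[u] = FEv l m n (u i1 + u i2 + u i3).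
Proof. by rewrite /FE1; ev_tac. Qed.
Lemma meval_FE2 l m n u : (FE2 l m n).@[u] = FEv l m n (u i2 + u i3 - u i1).
Proof. by rewrite /FE2; ev_tac. Qed.
Lemma meval_FE3 l m n u : (FE3 l m n).@[u] = FEv l m n (u i1 + u i3 - u i2).
Proof. by rewrite /FE3; ev_tac. Qed.
Lemma meval_FE4 l m n u : (FE4 l m n).@[u] = FEv l m n (u i1 + u i2 - u i3).
Proof. by rewrite /FE4; ev_tac. Qed.

Lemma poly_fun_inj (p q : {poly K}) : (forall t, p.[t] = q.[t]) -> p = q.
Proof.
by move=> h; apply/subr0_eq/poly_fun_eq0 => t; rewrite hornerD hornerN h subrr.
Qed.

Lemma horner_fac_prod4 (a b c d : option K) t : (\prod_(z <- [:: a; b; c; d]) fac z).[t] =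
  (fac a).[t] * ((fac b).[t] * ((fac c).[t] * (fac d).[t])).
Proof. by rewrite horner_prod !big_cons big_nil /= mulr1. Qed.

Lemma horner_fac (z : option K) t : (fac z).[t] = if z is Some r then t - r else -1.
Proof. by case: z => [r|]; rewrite /fac !hornerE. Qed.

Lemma PA_factor k : k ^+ 2 != 0 -> PA k =
  k ^+ 2 *: \prod_(z <- [:: Some 1; Some (-1); Some k^-1; Some (- k^-1)]) fac z.
Proof.
rewrite sqrf_eq0 => k0; apply: poly_fun_inj => t.
by rewrite hornerZ horner_fac_prod4 !horner_fac /PA !hornerE /=; field.
Qed.

Lemma PB_factor e :
  PB e = 1 *: \prod_(z <- [:: Some e; Some (- e); None; None]) fac z.
Proof.
apply: poly_fun_inj => t.
by rewrite hornerZ horner_fac_prod4 !horner_fac /PB !hornerE /=; ring.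
Qed.

Lemma PC_factor :
  @PC R = 1 *: \prod_(z <- [:: Some 0; Some 0; None; None]) fac z.
Proof.
apply: poly_fun_inj => t.
by rewrite hornerZ horner_fac_prod4 !horner_fac /PC !hornerE /=; ring.
Qed.

(** The sign stems from three factors [fac None], each -1. *)
Lemma PD_factor :
  @PD R = (-1) *: \prod_(z <- [:: Some 0; None; None; None]) fac z.
Proof.
apply: poly_fun_inj => t.
by rewrite hornerZ horner_fac_prod4 !horner_fac /PD !hornerE /=; ring.
Qed.

Lemma PE_factor :
  @PE R = 1 *: \prod_(z <- [:: None; None; None; None]) fac z.
Proof.
apply: poly_fun_inj => t.
by rewrite hornerZ horner_fac_prod4 !horner_fac /PE !hornerE /=; ring.
Qed.

Lemma zero_type1111 P (c : K) (z1 z2 z3 z4 : option K) : c != 0 ->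
  P = c *: \prod_(z <- [:: z1; z2; z3; z4]) fac z -> uniq [:: z1; z2; z3; z4] ->
  zero_type P [:: 1; 1; 1; 1]%N.
Proof.
move=> c0 PE u; have := u; rewrite /= !inE !negb_or.
case/and4P => /and3P[n12 n13 n14] /andP[n23 n24] n34 _.
apply: (factored_zero_type c0 PE erefl u) => //=.
by rewrite !eqxx !(eq_sym z2 z1, eq_sym z3 z1, eq_sym z4 z1, eq_sym z3 z2, eq_sym z4 z2,
  eq_sym z4 z3) !(negPf n12, negPf n13, negPf n14, negPf n23, negPf n24, negPf n34).
Qed.

Lemma zero_type112 P (c : K) (z1 z2 z3 : option K) : c != 0 ->
  P = c *: \prod_(z <- [:: z1; z2; z3; z3]) fac z -> uniq [:: z1; z2; z3] ->
  zero_type P [:: 1; 1; 2]%N.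
Proof.
move=> c0 PE u; have := u; rewrite /= !inE !negb_or.
case/and3P => /andP[n12 n13] n23 _.
apply: (factored_zero_type c0 PE erefl u) => //=.
  by rewrite !eqxx !(eq_sym z2 z1, eq_sym z3 z1, eq_sym z3 z2)
    !(negPf n12, negPf n13, negPf n23).
by move=> z; rewrite !inE orbb.
Qed.

Lemma zero_type22 P (c : K) (z1 z2 : option K) : c != 0 ->
  P = c *: \prod_(z <- [:: z1; z1; z2; z2]) fac z -> z1 != z2 ->
  zero_type P [:: 2; 2]%N.
Proof.
move=> c0 PE n12.
apply: (factored_zero_type c0 PE erefl (ws := [:: z1; z2])) => //=.
- by rewrite inE n12.
- by rewrite !eqxx !(eq_sym z2 z1) !(negPf n12).
by move=> z; rewrite !inE orbb orbA orbb.
Qed.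

Lemma zero_type13 P (c : K) (z1 z2 : option K) : c != 0 ->
  P = c *: \prod_(z <- [:: z1; z2; z2; z2]) fac z -> z1 != z2 ->
  zero_type P [:: 1; 3]%N.
Proof.
move=> c0 PE n12.
apply: (factored_zero_type c0 PE erefl (ws := [:: z1; z2])) => //=.
- by rewrite inE n12.
- by rewrite !eqxx !(eq_sym z2 z1) !(negPf n12).
by move=> z; rewrite !inE !orbb.
Qed.

Lemma zero_type4 P (c : K) (z1 : option K) : c != 0 ->
  P = c *: \prod_(z <- [:: z1; z1; z1; z1]) fac z -> zero_type P [:: 4]%N.
Proof.
move=> c0 PE.
apply: (factored_zero_type c0 PE erefl (ws := [:: z1])) => //=.
- by rewrite !eqxx.
by move=> z; rewrite !inE !orbb.
Qed.

Lemma canonical_A k : k ^+ 2 != 0 -> k ^+ 2 != 1 ->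
  zero_type (PA k) [:: 1; 1; 1; 1]%N /\ strongly_discr_sep (FA k) (PA k).
Proof.
move=> k0 k1; have PE := PA_factor k0; split.
  apply: (zero_type1111 k0 PE); rewrite /= !inE !negb_or.
  have kn0 : k != 0 by move: k0; rewrite sqrf_eq0.
  have n1 : (1 : K) != -1 by rewrite -addr_eq0 (_ : 1 + 1 = 2) ?nz2.
  have n2 : k^-1 != - k^-1.
    by rewrite -addr_eq0 -mulr2n -mulr_natl mulf_neq0 ?nz2 // invr_eq0.
  have n3 (e : K) : e ^+ 2 = 1 -> e != k^-1.
    by move=> e2; apply: contra_neq k1 => ek; rewrite -[k]invrK -ek exprVn e2 invr1.
  have e1 : (1 : K) ^+ 2 = 1 by rewrite expr1n.
  have e2 : (-1 : K) ^+ 2 = 1 by rewrite sqrrN expr1n.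
  have n4 (e : K) : e ^+ 2 = 1 -> e != - k^-1.
    by move=> ee; rewrite -eqr_oppLR; apply: n3; rewrite sqrrN.
  have so (a b : K) : (Some a == Some b) = (a == b) by [].
  by rewrite !so n1 n2 !n3 // !n4.
apply: (strongly_discr_sepI (meval_FA k) (@deg_FA k) (factored_neq0 k0 PE)).
  by rewrite (factored_size k0 PE erefl) leq_subr.
by apply: (eq_sdsv (sdsv_FA _)) => t; rewrite /PA !hornerE.
Qed.

Lemma canonical_B e : e != 0 ->
  zero_type (PB e) [:: 1; 1; 2]%N /\ strongly_discr_sep (FB e) (PB e).
Proof.
move=> e0; have PE := PB_factor e; have c0 := oner_neq0 K; split.
  apply: (zero_type112 c0 PE); rewrite /= !inE !andbT orbF.
  have -> : (Some e == Some (- e)) = (e == - e) by [].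
  by rewrite -addr_eq0 -mulr2n -mulr_natl mulf_neq0 ?nz2.
apply: (strongly_discr_sepI (meval_FB e) (@deg_FB e) (factored_neq0 c0 PE)).
  by rewrite (factored_size c0 PE erefl) leq_subr.
by apply: (eq_sdsv (sdsv_FB _)) => t; rewrite /PB !hornerE.
Qed.

Lemma canonical_C : zero_type (@PC R) [:: 2; 2]%N /\
  (forall l m n : K, m ^+ 2 - 4 * l * n = 1 ->
    [/\ strongly_discr_sep (FC1 l m n) PC, strongly_discr_sep (FC2 l m n) PC,
        strongly_discr_sep (FC3 l m n) PC & strongly_discr_sep (FC4 l m n) PC]).
Proof.
have PE := PC_factor; have c0 := oner_neq0 K.
have P0 := factored_neq0 c0 PE.
have sP : (size (@PC R) <= 5)%N by rewrite (factored_size c0 PE erefl) leq_subr.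
split=> [|l m n h]; first exact: (zero_type22 c0 PE).
split.
- apply: (strongly_discr_sepI (meval_FC1 l m n) (@deg_FC1 l m n) P0 sP).
  by apply: (eq_sdsv (sdsv_FC1 h)) => t; rewrite /PC !hornerE.
- apply: (strongly_discr_sepI (meval_FC2 l m n) (@deg_FC2 l m n) P0 sP).
  by apply: (eq_sdsv (sdsv_FC2 h)) => t; rewrite /PC !hornerE.
- apply: (strongly_discr_sepI (meval_FC3 l m n) (@deg_FC3 l m n) P0 sP).
  by apply: (eq_sdsv (sdsv_FC3 h)) => t; rewrite /PC !hornerE.
- apply: (strongly_discr_sepI (meval_FC4 l m n) (@deg_FC4 l m n) P0 sP).
  by apply: (eq_sdsv (sdsv_FC4 h)) => t; rewrite /PC !hornerE.
Qed.

Lemma canonical_D : zero_type (@PD R) [:: 1; 3]%N /\ strongly_discr_sep (@FD R) PD.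
Proof.
have PE := PD_factor; have c0 : -1 != 0 :> K by rewrite oppr_eq0 oner_neq0.
split; first exact: (zero_type13 c0 PE).
apply: (strongly_discr_sepI meval_FD deg_FD (factored_neq0 c0 PE)).
  by rewrite (factored_size c0 PE erefl) leq_subr.
by apply: (eq_sdsv (@sdsv_FD _)) => t; rewrite /PD !hornerE.
Qed.

Lemma canonical_E : zero_type (@PE R) [:: 4]%N /\
  (forall l m n : K, m ^+ 2 - 4 * l * n = 1 ->
    [/\ strongly_discr_sep (FE1 l m n) PE, strongly_discr_sep (FE2 l m n) PE,
        strongly_discr_sep (FE3 l m n) PE & strongly_discr_sep (FE4 l m n) PE]).
Proof.
have PEf := PE_factor; have c0 := oner_neq0 K.
have P0 := factored_neq0 c0 PEf.
have sP : (size (@PE R) <= 5)%N by rewrite (factored_size c0 PEf erefl) leq_subr.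
split=> [|l m n h]; first exact: (zero_type4 c0 PEf).
split.
- apply: (strongly_discr_sepI (h := fun x y z => FEv l m n (x + y + z))
    (meval_FE1 l m n) (@deg_FE1 l m n) P0 sP).
  by apply: (eq_sdsv (sdsv_FE1 h)) => t; rewrite /PE !hornerE.
- apply: (strongly_discr_sepI (h := fun x y z => FEv l m n (y + z - x))
    (meval_FE2 l m n) (@deg_FE2 l m n) P0 sP).
  by apply: (eq_sdsv (sdsv_FE2 h)) => t; rewrite /PE !hornerE.
- apply: (strongly_discr_sepI (h := fun x y z => FEv l m n (x + z - y))
    (meval_FE3 l m n) (@deg_FE3 l m n) P0 sP).
  by apply: (eq_sdsv (sdsv_FE3 h)) => t; rewrite /PE !hornerE.
- apply: (strongly_discr_sepI (h := fun x y z => FEv l m n (x + y - z))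
    (meval_FE4 l m n) (@deg_FE4 l m n) P0 sP).
  by apply: (eq_sdsv (sdsv_FE4 h)) => t; rewrite /PE !hornerE.
Qed.

End Canonical.

(** * Classification according to the zeros *)

Section Classification.
Variable R : realType.
Local Notation K := R[i].
Local Notation V := (K * K)%type.
Implicit Types (f : V -> V -> V -> K) (F G : {mpoly K[3]}) (P : {poly K}).
Implicit Types (z w : option K) (zs : seq (option K)).

Definition hpt z : V := if z is Some r then (r, 1) else (1, 0).

Definition hfac z (x : V) : K := (hpt z).2 * x.1 - (hpt z).1 * x.2.

Definition hprod (k : K) zs (x : V) : K := k * \prod_(z <- zs) hfac z x.

(** The bracket of two points: up to sign, the determinant of their homogeneous coordinates. *)
Definition br z w : K := hfac z (hpt w).

Lemma br_eq0 z w : (br z w == 0) = (z == w).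
Proof.
case: z w => [r|] [s|]; rewrite /br /hfac /= ?mul1r ?mulr1 ?mul0r ?mulr0 ?subr0 ?sub0r.
- by rewrite subr_eq0 eq_sym.
- by rewrite oner_eq0.
- by rewrite oppr_eq0 oner_eq0.
- by rewrite !eqxx.
Qed.

Lemma br_self z : br z z = 0.
Proof. by apply/eqP; rewrite br_eq0. Qed.

(** The substitution after which the zero a is at infinity and b at 0. *)
Definition frame a b : K * K * (K * K) :=
  (((hpt a).1, (hpt b).1), ((hpt a).2, (hpt b).2)).

Lemma hfac_frame a b z x : hfac z (mact (frame a b) x) = br z a * x.1 + br z b * x.2.
Proof. by rewrite /br /hfac /mact /frame /=; ring. Qed.

Lemma det_frame a b : mdet (frame a b) = br b a.
Proof. by rewrite /mdet /frame /br /hfac /=; ring. Qed.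

Lemma horner_hfac z (t : K) : (fac z).[t] = hfac z (t, 1).
Proof. by case: z => [r|]; rewrite /fac /hfac /= !hornerE; ring. Qed.

Lemma hprod_affine P k zs (t : K) : P = k *: \prod_(z <- zs) fac z ->
  P.[t] = hprod k zs (t, 1).
Proof.
move=> ->; rewrite hornerZ horner_prod /hprod; congr (_ * _).
by apply: eq_bigr => z _; apply: horner_hfac.
Qed.

Lemma hprod4 k a b c d x : hprod k [:: a; b; c; d] x =
  k * (hfac a x * (hfac b x * (hfac c x * hfac d x))).
Proof. by rewrite /hprod !big_cons big_nil /= mulr1. Qed.

Lemma quartic_hprod k a b c d : quartic (hprod k [:: a; b; c; d]).
Proof.
pose u i := (hpt (nth None [:: a; b; c; d] i)).2.
pose v i := - (hpt (nth None [:: a; b; c; d] i)).1.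
have [e he] := quartic_linear4 k u v; exists e => x; rewrite -he hprod4.
by rewrite /hfac /u /v /=; ring.
Qed.

Lemma eq_sds f q q' : q =1 q' -> sds f q -> sds f q'.
Proof. by move=> e h x y; rewrite -!e; apply: h. Qed.

Lemma sds_form F P k a b c d : strongly_discr_sep F P ->
  P = k *: \prod_(z <- [:: a; b; c; d]) fac z -> sds (hform F) (hprod k [:: a; b; c; d]).
Proof.
move=> sF PE; have [dF _ _ _] := sF.
apply: sds_affineW (triq_form dF) (quartic_hprod k a b c d) _ => s t.
by have := form_sds_affine sF s t; rewrite !(hprod_affine _ PE).
Qed.

Lemma to_cubic f k a b c d : triq f -> sds f (hprod k [:: a; b; c; d]) ->
  k != 0 -> a != b -> a != c -> a != d ->
  exists r1 r2, [/\ (r1 == 0) = (c == b), (r2 == 0) = (d == b), (r1 == r2) = (c == d) &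
    exists u v, eqv f (FW (- (u + v)) (- (u * v))) /\
    [\/ u = r1 /\ v = r2, [/\ u = - r1, v = r2 - r1, u != 0 & v != 0] |
        [/\ u = - r2, v = r1 - r2, u != 0 & v != 0]]].
Proof.
move=> tf sf k0 ab ac ad.
have ba0 : br b a != 0 by rewrite br_eq0 eq_sym.
have ab0 : br a b != 0 by rewrite br_eq0.
have ca0 : br c a != 0 by rewrite br_eq0 eq_sym.
have da0 : br d a != 0 by rewrite br_eq0 eq_sym.
have dM : mdet (frame a b) != 0 by rewrite det_frame.
have r0 (e : option K) : br e a != 0 -> (- (br e b / br e a) == 0) = (e == b).
  by move=> e0; rewrite oppr_eq0 mulf_eq0 invr_eq0 (negPf e0) orbF br_eq0.
(* The positions of c and d in the coordinate given by [frame a b]. *)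
exists (- (br c b / br c a)), (- (br d b / br d a)); split; rewrite ?r0 //.
  rewrite eqr_opp (can2_eq (mulfVK ca0) (mulfK ca0)) mulrAC -(can2_eq (mulfK da0) (mulfVK da0)).
  rewrite -subr_eq0.
  (* The Plücker relation between the brackets of four points. *)
  have -> : br c b * br d a - br d b * br c a = br b a * br c d.
    by rewrite /br /hfac; ring.
  by rewrite mulf_eq0 (negPf ba0) br_eq0.
have tM := triq_act (frame a b) tf; have sM := sds_act (frame a b) tf sf.
have [||u [v [e uv]]] := cubic (r1 := - (br c b / br c a)) (r2 := - (br d b / br d a))
    (l := mdet (frame a b) * (k * (br a b * br b a * br c a * br d a))) tM sM.
- by rewrite !mulf_neq0.
- move=> t; rewrite hprod4 !hfac_frame !br_self /=; field; exact/andP.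
by exists u, v; split=> //; apply: (eqv_trans (eqv_act f dM) e).
Qed.

Lemma classify_A f k a b c d : triq f -> sds f (hprod k [:: a; b; c; d]) -> k != 0 ->
  uniq [:: a; b; c; d] ->
  exists k' : K, [/\ k' ^+ 2 != 0, k' ^+ 2 != 1 & eqva f (FAv k')].
Proof.
move=> tf sf k0; rewrite /= !inE !negb_or.
case/and4P=> /and3P[ab ac ad] /andP[bc bd] cd _.
have [r1 [r2 [h1 h2 h12 [u [v [e uv]]]]]] := to_cubic tf sf k0 ab ac ad.
have r10 : r1 != 0 by rewrite h1 eq_sym.
have r20 : r2 != 0 by rewrite h2 eq_sym.
have r12 : r1 != r2 by rewrite h12.
(* Moving the origin to another zero keeps the three finite zeros distinct. *)
have [u0 v0 n] : [/\ u != 0, v != 0 & u != v].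
  case: uv => [[-> ->] //|[-> -> u0 v0]|[-> -> u0 v0]]; split=> //.
    by rewrite -subr_eq0 (_ : _ - _ = - r2) ?oppr_eq0 //; ring.
  by rewrite -subr_eq0 (_ : _ - _ = - r1) ?oppr_eq0 //; ring.
have [k' [k1 k2 e']] := FW_A u0 v0 n (eqv_triq e tf).
by exists k'; split=> //; apply: (eqv_eqva e e').
Qed.

Lemma classify_B f k a b c : triq f -> sds f (hprod k [:: a; b; c; c]) -> k != 0 ->
  uniq [:: a; b; c] -> eqva f (FBv 1).
Proof.
move=> tf sf k0; rewrite /= !inE !negb_or => /and3P[/andP[ab ac] bc _].
have [r1 [r2 [h1 _ h12 [u [v [e uv]]]]]] := to_cubic tf sf k0 ab ac ac.
have r10 : r1 != 0 by rewrite h1 eq_sym.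
have /eqP r12 : r1 == r2 by rewrite h12.
(* The double zero cannot become the origin, since u or v would then be 0. *)
have [uE vE] : u = r1 /\ v = r1.
  by case: uv => [[-> ->]|[_ ->]|[_ ->]]; rewrite r12 ?subrr ?eqxx.
rewrite uE vE in e.
apply: (eqv_eqva e).
exact: (FW_B r10 (eqv_triq e tf)).
Qed.

Lemma classify_D f k a b : triq f -> sds f (hprod k [:: a; b; b; b]) -> k != 0 ->
  a != b -> eqva f (@FDv _).
Proof.
move=> tf sf k0 ab.
have [r1 [r2 [h1 h2 _ [u [v [e uv]]]]]] := to_cubic tf sf k0 ab ab ab.
have /eqP r10 : r1 == 0 by rewrite h1.
have /eqP r20 : r2 == 0 by rewrite h2.
have [uE vE] : u = 0 /\ v = 0.
  by case: uv => [[-> ->]|[->]|[->]]; rewrite ?r10 ?r20 ?oppr0 ?eqxx.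
rewrite uE vE mulr0 addr0 oppr0 in e.
exact: (eqv_eqva e (FW_D (eqv_triq e tf))).
Qed.

Lemma eqva_scaled f (c : K) h : triq f -> c != 0 ->
  eqva (fun x y z : V => c * f x y z) h -> eqva f h.
Proof.
move=> tf c0; apply: eqv_eqva.
exact: (@eqv_scale _ c f (fun x y z : V => c * f x y z)).
Qed.

Lemma classify_C f k a b : triq f -> sds f (hprod k [:: a; a; b; b]) -> k != 0 ->
  a != b -> exists l m n : K, m ^+ 2 - 4 * l * n = 1 /\
  [\/ eqva f (FCv1 l m n), eqva f (FCv2 l m n), eqva f (FCv3 l m n)
    | eqva f (FCv4 l m n)].
Proof.
move=> tf sf k0 ab.
have ba0 : br b a != 0 by rewrite br_eq0 eq_sym.
have ab0 : br a b != 0 by rewrite br_eq0.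
have dM : mdet (frame a b) != 0 by rewrite det_frame.
have tM := triq_act (frame a b) tf; have sM := sds_act (frame a b) tf sf.
(* The constant left in q in the new coordinates; since q scales with f, multiplying f by its
   inverse removes it. *)
pose l0 := mdet (frame a b) * (k * (br a b ^+ 2 * br b a ^+ 2)).
have l0n : l0 != 0 by rewrite !mulf_neq0 ?expf_neq0.
have sN := sds_scale l0^-1 sM.
have [|l [m [n [h e]]]] := toric (triq_scale l0^-1 tM) (eq_sds _ sN).
  move=> x; rewrite hprod4 !hfac_frame !br_self /l0.
  by field; rewrite dM k0 ab0 ba0.
have up g : eqva (fun x y z : V => l0^-1 * mobius_act (frame a b) f x y z) g -> eqva f g.
  move=> eg; apply: (eqv_eqva (eqv_act f dM)).
  by apply: eqva_scaled eg; rewrite ?invr_eq0.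
exists l, m, n; split=> //.
by case: e => /up; [apply: Or41|apply: Or42|apply: Or43|apply: Or44].
Qed.

Lemma classify_E f k a : triq f -> sds f (hprod k [:: a; a; a; a]) -> k != 0 ->
  exists l m n : K, m ^+ 2 - 4 * l * n = 1 /\
  [\/ eqva f (fun x y z : K => FEv l m n (x + y + z)),
      eqva f (fun x y z : K => FEv l m n (y + z - x)),
      eqva f (fun x y z : K => FEv l m n (x + z - y)) |
      eqva f (fun x y z : K => FEv l m n (x + y - z))].
Proof.
move=> tf sf k0.
(* Any second point completes the frame. *)
pose b : option K := if a is Some _ then None else Some 0.
have ab : a != b by rewrite /b; case: (a).
have ab0 : br a b != 0 by rewrite br_eq0.
have dM : mdet (frame a b) != 0 by rewrite det_frame br_eq0 eq_sym.
have tM := triq_act (frame a b) tf; have sM := sds_act (frame a b) tf sf.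
pose l0 := mdet (frame a b) * (k * br a b ^+ 4).
have l0n : l0 != 0 by rewrite !mulf_neq0 ?expf_neq0.
have sN := sds_scale l0^-1 sM.
have [|l [m [n [h e]]]] := translation (triq_scale l0^-1 tM) (eq_sds _ sN).
  move=> x; rewrite hprod4 !hfac_frame !br_self /l0.
  by field; rewrite dM k0 ab0.
have up g : eqva (fun x y z : V => l0^-1 * mobius_act (frame a b) f x y z) g -> eqva f g.
  move=> eg; apply: (eqv_eqva (eqv_act f dM)).
  by apply: eqva_scaled eg; rewrite ?invr_eq0.
exists l, m, n; split=> //.
by case: e => /up; [apply: Or41|apply: Or42|apply: Or43|apply: Or44].
Qed.

End Classification.

Theorem theorem1 (R : realType) :
  (forall (F : {mpoly R[i][3]}) (P : {poly R[i]}),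
    strongly_discr_sep F P ->
    [\/ zero_type P [:: 1; 1; 1; 1]%N /\
        (exists k : R[i],
           [/\ k ^+ 2 != 0, k ^+ 2 != 1 & equivalent F (FA k)]),
        zero_type P [:: 1; 1; 2]%N /\
        (exists e : R[i], e != 0 /\ equivalent F (FB e)),
        zero_type P [:: 2; 2]%N /\
        (exists l m n : R[i], m ^+ 2 - 4 * l * n = 1 /\
           [\/ equivalent F (FC1 l m n), equivalent F (FC2 l m n),
               equivalent F (FC3 l m n) | equivalent F (FC4 l m n)])
      | (zero_type P [:: 1; 3]%N /\ equivalent F FD) \/
        (zero_type P [:: 4]%N /\
         (exists l m n : R[i], m ^+ 2 - 4 * l * n = 1 /\
           [\/ equivalent F (FE1 l m n), equivalent F (FE2 l m n),
               equivalent F (FE3 l m n) | equivalent F (FE4 l m n)]))])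
  /\
  (* each listed polynomial satisfies the condition with the canonical P,
     and the canonical P has the zeros of its type *)
  [/\ forall k : R[i], k ^+ 2 != 0 -> k ^+ 2 != 1 ->
        zero_type (PA k) [:: 1; 1; 1; 1]%N /\
        strongly_discr_sep (FA k) (PA k),
      forall e : R[i], e != 0 ->
        zero_type (PB e) [:: 1; 1; 2]%N /\
        strongly_discr_sep (FB e) (PB e),
      zero_type (@PC R) [:: 2; 2]%N /\
      (forall l m n : R[i], m ^+ 2 - 4 * l * n = 1 ->
        [/\ strongly_discr_sep (FC1 l m n) PC,
            strongly_discr_sep (FC2 l m n) PC,
            strongly_discr_sep (FC3 l m n) PC &
            strongly_discr_sep (FC4 l m n) PC]),
      zero_type (@PD R) [:: 1; 3]%N /\
      strongly_discr_sep (@FD R) PD &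
      zero_type (@PE R) [:: 4]%N /\
      (forall l m n : R[i], m ^+ 2 - 4 * l * n = 1 ->
        [/\ strongly_discr_sep (FE1 l m n) PE,
            strongly_discr_sep (FE2 l m n) PE,
            strongly_discr_sep (FE3 l m n) PE &
            strongly_discr_sep (FE4 l m n) PE])].
Proof.
split; last first.
  split; [exact: canonical_A|exact: canonical_B|exact: canonical_C
         |exact: canonical_D|exact: canonical_E].
move=> F P sF; have [dF P0 sP _] := sF.
have [k [zs [k0 s4 PE]]] := factor_exists P0 sP.
have [a [b [c [d [zsE cases]]]]] := seq4_cases s4.
have {}PE : P = k *: \prod_(z <- [:: a; b; c; d]) fac z by rewrite PE (perm_big _ zsE).
have tF := triq_form dF; have sQ := sds_form sF PE.
case: cases => [u|[u e]|[e e' u]|[[u [e e']]|[e e' e'']]];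
  [|subst d|subst b d|subst c d|subst b c d].
- apply: Or41; split; first exact: (zero_type1111 k0 PE u).
  have [k' [k1 k2 h]] := classify_A tF sQ k0 u; exists k'; split=> //.
  exact: (eqva_equivalent dF (meval_FA k') h).
- apply: Or42; split; first exact: (zero_type112 k0 PE u).
  (* Scaling the coordinate takes the simple zeros e and - e to 1 and -1, so one member of the
     family suffices. *)
  exists 1; split; first exact: oner_neq0.
  exact: (eqva_equivalent dF (meval_FB 1) (classify_B tF sQ k0 u)).
- apply: Or43; split; first exact: (zero_type22 k0 PE u).
  have [l [m [n [h e]]]] := classify_C tF sQ k0 u; exists l, m, n; split=> //.
  case: e => e; [apply: Or41|apply: Or42|apply: Or43|apply: Or44].
  + exact: (eqva_equivalent dF (meval_FC1 l m n) e).
  + exact: (eqva_equivalent dF (meval_FC2 l m n) e).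
  + exact: (eqva_equivalent dF (meval_FC3 l m n) e).
  + exact: (eqva_equivalent dF (meval_FC4 l m n) e).
- apply: Or44; left; split; first exact: (zero_type13 k0 PE u).
  exact: (eqva_equivalent dF (@meval_FD R) (classify_D tF sQ k0 u)).
- apply: Or44; right; split; first exact: (zero_type4 k0 PE).
  have [l [m [n [h e]]]] := classify_E tF sQ k0; exists l, m, n; split=> //.
  case: e => e; [apply: Or41|apply: Or42|apply: Or43|apply: Or44].
  + exact: (eqva_equivalent dF (meval_FE1 l m n) e).
  + exact: (eqva_equivalent dF (meval_FE2 l m n) e).
  + exact: (eqva_equivalent dF (meval_FE3 l m n) e).
  + exact: (eqva_equivalent dF (meval_FE4 l m n) e).
Qed.
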